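(* Let $G$ be a finitely generated group and let $H\le G$ be a finitely generated subgroup of infinite index. Let $G_1$ be a subgroup of finite index in $G$ such that $H\le G_1$ and let $\phi:G_1\to\overline{G}$ be an epimorphism. Assume that $\overline{H}=\phi(H)$ is contained in a subgroup $\overline{K}$ of infinite index in $\overline{G}$ such that the membership problem for $\overline{K}$ in $\overline{G}$ is in the complexity class $\mathcal{C}$. Then the membership problem for $H$ in $G$ has generic-case complexity in $\mathcal{C}$. Moreover, if the Schreier coset graph $\Gamma(\overline{G},\overline{K},A)$ is non-amenable (for some and hence any finite generating set $A$ of $\overline{G}$), then the generic-case complexity of the membership problem for $H$ in $G$ is strongly in $\mathcal{C}$.
   Context: Complexity classes. A complexity class $\mathcal{C}$ is specified by the model of computation (always a multi-tape Turing machine), a mode of computation (e.g. deterministic or non-deterministic), the resources to be controlled (time or space or a combination thereof), and, for each controlled resource, a collection of bounding functions $f$: on an input $w$ at most $f(|w|)$ units of the resource may be used. Each collection consists of proper complexity functions $f(n)>0$, and for every $f$ in the collection and every integer $C\ge 1$ the function $n\mapsto Cf(Cn+C)+C$ is also in the collection. (A proper complexity function is a non-decreasing function $f$ for which there is a multi-tape Turing machine which on input $w$ computes the string $1^{f(|w|)}$ in $O(|w|+f(|w|))$ steps and uses $O(f(|w|))$ space besides its input.) Membership problem. If $A$ is a finite generating set of a group $G$ (i.e. a finite set with a map $\pi:A\to G$ whose image generates $G$), let $X=A\cup A^{-1}$ ($A^{-1}$ the set of formal inverses), let $X^*$ be the set of all words over $X$, and extend $\pi$ to $X^*\to G$. For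 a subgroup $H\le G$, the membership problem with respect to $A$ is the set $MP(G,H,A)=\{w\in X^*:\pi(w)\in H\}$. The membership problem for $H$ in $G$ is in $\mathcal{C}$ if for every finite generating set $A$ of $G$ the language $MP(G,H,A)$ is in $\mathcal{C}$. Genericity. For a finite alphabet $X$ with at least two elements and $S\subseteq X^*$, let $B_n$ be the set of words of length at most $n$ and $\rho_n(S)=|S\cap B_n|/|B_n|$. $S$ is generic if $\lim_{n\to\infty}\rho_n(S)=1$, and strongly generic if in addition the convergence is exponentially fast, i.e. there are $0\le\sigma<1$ and $C>0$ with $1-\rho_n(S)\le C\sigma^n$ for all $n\ge1$. Generic-case complexity. Let $\mathcal{D}\subseteq X^*$. A partial algorithm $\Omega$ is correct for $\mathcal{D}$ if whenever it reaches a decision on whether an input belongs to $\mathcal{D}$, that decision is correct. A correct partial algorithm $\Omega$ solves $\mathcal{D}$ with generic-case complexity $\mathcal{C}$ (resp. strongly $\mathcal{C}$) if there is a generic (resp. strongly generic) $S\subseteq X^*$ such that on every input from $S$ the algorithm terminates with a decision within the complexity bound $\mathcal{C}$. The membership problem for $H$ in $G$ has generic-case complexity in $\mathcal{C}$ (strongly in $\mathcal{C}$) if for every finite generating set $A$ of $G$ there is a correct partial algorithm solving $MP(G,H,A)$ with generic-case complexity $\mathcal{C}$ (strongly $\mathcal{C}$). Coset graph and amenability. The Schreier coset graph $\Gamma(G,H,A)$ has vertex set $\{Hg: g\in G\}$, and for each $a\in A$ and each coset $Hg$ an edge labeled $a$ from $Hg$ to $Hga$, with a formal inverse edge labeled $a^{-1}$;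 it is a connected $2|A|$-regular graph. For a connected $d$-regular graph $\Gamma$ ($d\ge2$) with base-vertex $x_0$ let $b_n$ be the number of edge-paths of length $n$ from $x_0$ to $x_0$. The spectral radius is $\nu(\Gamma)=\frac1d\limsup_{n\to\infty}\sqrt[n]{b_n}$ (independent of $x_0$), and $\Gamma$ is amenable if $\nu(\Gamma)=1$ and non-amenable otherwise. *)

(* Defs.v *)
From HB Require Import structures.
From mathcomp Require Import all_boot all_order all_algebra finmap.
From mathcomp Require Import all_classical all_reals all_analysis.

Set Implicit Arguments.
Unset Strict Implicit.
Unset Printing Implicit Defensive.

Import Order.TTheory GRing.Theory Num.Theory.
Import numFieldNormedType.Exports.

Local Open Scope classical_set_scope.

(** * Multi-tape Turing machines *)

Inductive dir := Left | Stay | Right.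

(* A bi-infinite tape of which only the visited part is stored: the cells to
   the left of the head (nearest first), the scanned cell, the cells to its
   right.  Unvisited cells are blank. *)
Record tape (S : Type) := Tape { tleft : seq S; thead : S; tright : seq S }.

Definition tape_content S (t : tape S) : seq S :=
  rev (tleft t) ++ thead t :: tright t.

Definition tape_size S (t : tape S) : nat := size (tape_content t).

Definition write_move S (blank : S) (t : tape S) (a : S * dir) : tape S :=
  let: Tape l _ r := t in
  let: (s, d) := a in
  match d with
  | Stay => Tape l s r
  | Left => if l is x :: l' then Tape l' x (s :: r) else Tape [::] blank (s :: r)
  | Right => if r is x :: r' then Tape (s :: l) x r' else Tape (s :: l) blank [::]
  end.

(* A machine with a two-way read-only input tape over X and tm_tapes read-write
   work tapes.  At each step it makes one of tm_branch.+1 choices, which, with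
   the state and the scanned symbols, determines the step: the machine is
   deterministic when tm_branch = 0.  A state q is halting when tm_out q is
   Some b, b being the answer. *)
Record tm (X : finType) := TM {
  tm_state : finType;
  tm_sym : finType;
  tm_blank : tm_sym;
  tm_tapes : nat;
  tm_branch : nat;
  tm_start : tm_state;
  tm_out : tm_state -> option bool;
  tm_delta : tm_state -> option X -> {ffun 'I_tm_tapes -> tm_sym} ->
             'I_tm_branch.+1 ->
             tm_state * dir * {ffun 'I_tm_tapes -> tm_sym * dir} }.

Section Runs.
Variables (X : finType) (M : tm X) (w : seq X).

Record config := Config {
  cf_state : tm_state M;
  cf_pos : nat;
  cf_tapes : {ffun 'I_(tm_tapes M) -> tape (tm_sym M)} }.

(* The input w = x_1 ... x_n occupies the cells 1, ..., n of the input tape;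
   the cells 0 and n + 1 are blank (None) and bound the range of the head. *)
Definition input_symbol (p : nat) : option X :=
  if p is p'.+1 then onth w p' else None.

Definition input_move (p : nat) (d : dir) : nat :=
  match d with Left => p.-1 | Stay => p | Right => minn p.+1 (size w).+1 end.

Definition init_config : config :=
  Config (tm_start M) 1 [ffun=> Tape [::] (tm_blank M) [::]].

Definition answer (c : config) : option bool := tm_out (cf_state c).

(* Halting configurations are fixed. *)
Definition step (i : 'I_(tm_branch M).+1) (c : config) : config :=
  if answer c is Some _ then c else
  let: (q, d, acts) :=
    tm_delta (cf_state c) (input_symbol (cf_pos c))
             [ffun j => thead (cf_tapes c j)] i in
  Config q (input_move (cf_pos c) d)
         [ffun j => write_move (tm_blank M) (cf_tapes c j) (acts j)].

(* A computation on w is given by the sequence ch of choices made. *)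
Fixpoint run (ch : nat -> 'I_(tm_branch M).+1) (t : nat) : config :=
  if t is t'.+1 then step (ch t') (run ch t') else init_config.

Definition halted_at ch t : Prop := answer (run ch t) <> None.

Definition halts : Prop := forall ch, exists t, halted_at ch t.

Definition ends_with ch (b : bool) : Prop :=
  exists t, answer (run ch t) = Some b.

(* M reaches the decision "yes" if some computation accepts, and the decision
   "no" if every computation rejects (each computation halts and rejects). *)
Definition reaches_decision (b : bool) : Prop :=
  if b then exists ch, ends_with ch true else forall ch, ends_with ch false.

Definition within_time (n : nat) : Prop := forall ch, halted_at ch n.

Definition config_space (c : config) : nat :=
  \sum_(j < tm_tapes M) tape_size (cf_tapes c j).

Definition within_space (n : nat) : Prop :=
  forall ch t, config_space (run ch t) <= n.

End Runs.

(** * Complexity classes *)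

Inductive mode := Deterministic | Nondeterministic.

Definition has_mode (m : mode) (X : finType) (M : tm X) : Prop :=
  match m with Deterministic => tm_branch M = 0 | Nondeterministic => True end.

Definition output_is (X : finType) (M : tm X) (o : 'I_(tm_tapes M))
    (one : tm_sym M) (c : config M) (m : nat) : Prop :=
  exists i j, tape_content (cf_tapes c o) =
    nseq i (tm_blank M) ++ nseq m one ++ nseq j (tm_blank M).

(* The constants D bound the O(...)s; for the functions in a bounding family,
   which are positive, this agrees with the asymptotic notation. *)
Definition proper_complexity_function (f : nat -> nat) : Prop :=
  (forall m n, m <= n -> f m <= f n) /\
  forall X : finType, exists M : tm X, has_mode Deterministic M /\
    exists (o : 'I_(tm_tapes M)) (one : tm_sym M), one <> tm_blank M /\
    exists D : nat, forall (w : seq X) ch,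
      within_space M w (D * f (size w)) /\
      exists t, [/\ t <= D * (size w + f (size w)), halted_at w ch t &
                    output_is o one (run w ch t) (f (size w))].

Record bounding_family := BoundingFamily {
  bounds : set (nat -> nat);
  bounds_proper : forall f, bounds f -> proper_complexity_function f;
  bounds_gt0 : forall f, bounds f -> forall n, 0 < f n;
  bounds_closed : forall f, bounds f -> forall c, 1 <= c ->
    bounds (fun n => c * f (c * n + c) + c) }.

Inductive resources :=
  | Time of bounding_family
  | Space of bounding_family
  | TimeSpace of bounding_family & bounding_family.

Record complexity_class := ComplexityClass {
  class_mode : mode;
  class_resources : resources }.

Definition time_bounded (F : bounding_family) (X : finType) (M : tm X)
    (S : set (seq X)) : Prop :=
  exists2 f, bounds F f & forall w, S w -> within_time M w (f (size w)).

Definition space_bounded (F : bounding_family) (X : finType) (M : tm X)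
    (S : set (seq X)) : Prop :=
  exists2 f, bounds F f & forall w, S w -> within_space M w (f (size w)).

Definition resource_bounded (r : resources) (X : finType) (M : tm X)
    (S : set (seq X)) : Prop :=
  match r with
  | Time F => time_bounded F M S
  | Space F => space_bounded F M S
  | TimeSpace F F' => time_bounded F M S /\ space_bounded F' M S
  end.

Definition correct_for (X : finType) (M : tm X) (L : set (seq X)) : Prop :=
  forall w b, reaches_decision M w b -> if b then L w else ~ L w.

(* On every input from S, M halts with a decision, within the bounds of C. *)
Definition decides_on (C : complexity_class) (X : finType) (M : tm X)
    (S : set (seq X)) : Prop :=
  (forall w, S w -> halts M w /\ exists b, reaches_decision M w b) /\
  resource_bounded (class_resources C) M S.

Definition in_class (C : complexity_class) (X : finType) (L : set (seq X)) :
    Prop :=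
  exists M : tm X,
    [/\ has_mode (class_mode C) M, correct_for M L & decides_on C M setT].

(** * Genericity *)

Section Genericity.
Variables (R : realType) (X : finType).

Definition word_ball (n : nat) : set (seq X) := [set w | size w <= n].

Definition density (S : set (seq X)) (n : nat) : R :=
  (#|` fset_set (S `&` word_ball n)|%:R / #|` fset_set (word_ball n)|%:R)%R.

Definition generic (S : set (seq X)) : Prop :=
  density S n @[n --> \oo] --> (1 : R)%R.

Definition strongly_generic (S : set (seq X)) : Prop :=
  generic S /\
  exists sigma c : R, [/\ (0 <= sigma < 1)%R, (0 < c)%R &
    forall n, 1 <= n -> (1 - density S n <= c * sigma ^+ n)%R].

End Genericity.

Definition solved_generically (R : realType) (C : complexity_class)
    (X : finType) (L : set (seq X)) : Prop :=
  exists M : tm X, [/\ has_mode (class_mode C) M, correct_for M L &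
    exists2 S, generic R S & decides_on C M S].

Definition solved_strongly_generically (R : realType) (C : complexity_class)
    (X : finType) (L : set (seq X)) : Prop :=
  exists M : tm X, [/\ has_mode (class_mode C) M, correct_for M L &
    exists2 S, strongly_generic R S & decides_on C M S].

(** * Groups and membership problems *)

Local Open Scope group_scope.

Section Groups.
Variable G : groupType.
Implicit Types H S : set G.

Definition subgroup H : Prop :=
  [/\ H 1, forall x y, H x -> H y -> H (x * y) & forall x, H x -> H x^-1].

Definition generated S : set G := smallest subgroup S.

Definition finitely_generated H : Prop :=
  exists2 S, finite_set S & generated S = H.

Definition right_coset H (g : G) : set G := [set h * g | h in H].

Definition finite_index H : Prop := finite_set (range (right_coset H)).

Definition infinite_index H : Prop := infinite_set (range (right_coset H)).

Definition generating (A : finType) (pi : A -> G) : Prop :=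
  generated (range pi) = setT.

(* Words over A and its formal inverses: inl a stands for a, inr a for a^-1. *)
Definition letter_val (A : finType) (pi : A -> G) (x : A + A) : G :=
  match x with inl a => pi a | inr a => (pi a)^-1 end.

Definition word_val (A : finType) (pi : A -> G) (w : seq (A + A)%type) : G :=
  \prod_(x <- w) letter_val pi x.

Definition MP H (A : finType) (pi : A -> G) : set (seq (A + A)%type) :=
  [set w | H (word_val pi w)].

Definition membership_in (C : complexity_class) H : Prop :=
  forall (A : finType) (pi : A -> G), generating pi -> in_class C (MP H pi).

Definition membership_generically_in (R : realType) (C : complexity_class) H :
    Prop :=
  forall (A : finType) (pi : A -> G), generating pi ->
    solved_generically R C (MP H pi).

Definition membership_strongly_generically_in (R : realType)
    (C : complexity_class) H : Prop :=
  forall (A : finType) (pi : A -> G), generating pi ->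
    solved_strongly_generically R C (MP H pi).

End Groups.

(* A homomorphism defined on the subgroup H; phi is irrelevant outside H. *)
Definition morphism_on (G G' : groupType) (H : set G) (phi : G -> G') : Prop :=
  forall x y, H x -> H y -> phi (x * y) = phi x * phi y.

(** * Graphs, spectral radius, Schreier graphs *)

Record graph := Graph {
  vertex : choiceType;
  edge : choiceType;
  origin : edge -> vertex;
  terminus : edge -> vertex;
  reverse : edge -> edge;
  reverseK : involutive reverse;
  reverse_neq : forall e, reverse e <> e;
  origin_reverse : forall e, origin (reverse e) = terminus e }.

Fixpoint edge_path (T : graph) (x y : vertex T) (p : seq (edge T)) : Prop :=
  if p is e :: p' then origin e = x /\ edge_path (terminus e) y p' else x = y.

Definition degree (T : graph) (x : vertex T) : nat :=
  #|` fset_set [set e : edge T | origin e = x] |.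

Definition closed_path_count (T : graph) (x : vertex T) (n : nat) : nat :=
  #|` fset_set [set p : seq (edge T) | size p = n /\ edge_path x x p] |.

(* For a connected regular graph, with base-vertex x. *)
Definition spectral_radius (R : realType) (T : graph) (x : vertex T) : \bar R :=
  (((degree x)%:R^-1)%:E *
   limn_esup (fun n => ((closed_path_count x n)%:R `^ (n%:R^-1))%:E))%E.

Definition amenable (R : realType) (T : graph) (x : vertex T) : Prop :=
  spectral_radius R x = 1%E.

Section SchreierGraph.
Variables (G : groupType) (H : set G) (A : finType) (pi : A -> G).

Definition is_coset (K : set G) : bool := `[< exists g, K = right_coset H g >].

Definition coset : choiceType := {K : set G | is_coset K}.

Lemma right_coset_is_coset g : is_coset (right_coset H g).
Proof. by apply/asboolP; exists g. Qed.

Definition coset_of (g : G) : coset :=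
  exist _ (right_coset H g) (right_coset_is_coset g).

Lemma right_cosetM g h :
  right_coset (right_coset H g) h = right_coset H (g * h).
Proof.
apply/seteqP; split=> x /=.
  by case=> _ [y Hy <-] <-; exists y => //; rewrite mulgA.
by case=> y Hy <-; exists (y * g); [exists y | rewrite mulgA].
Qed.

Lemma coset_mul_subproof (K : coset) g : is_coset (right_coset (val K) g).
Proof.
case: K => K /= /asboolP[h ->]; rewrite right_cosetM.
exact: right_coset_is_coset.
Qed.

Definition coset_mul (K : coset) (g : G) : coset :=
  exist _ (right_coset (val K) g) (coset_mul_subproof K g).

Definition letter_inv (x : A + A) : (A + A)%type :=
  match x with inl a => inr a | inr a => inl a end.

(* The edge (K, x) is labelled by x. *)
Definition sg_edge : choiceType := (coset * (A + A))%type.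

Definition sg_terminus (e : sg_edge) : coset :=
  coset_mul e.1 (letter_val pi e.2).

Definition sg_reverse (e : sg_edge) : sg_edge :=
  (sg_terminus e, letter_inv e.2).

Lemma sg_reverseK : involutive sg_reverse.
Proof.
case=> K x; rewrite /sg_reverse /=; congr (_, _); last by case: x.
apply/val_inj; rewrite /= /sg_terminus /=.
suff -> : letter_val pi (letter_inv x) = (letter_val pi x)^-1.
  apply/seteqP; split=> y /=.
    by case=> _ [z Kz <-] <-; rewrite mulgK.
  move=> Ky; exists (y * letter_val pi x); first by exists y.
  by rewrite mulgK.
by case: x => a //=; rewrite invgK.
Qed.

Lemma sg_reverse_neq e : sg_reverse e <> e.
Proof. by case: e => K [] a []. Qed.

Definition schreier_graph : graph :=
  @Graph coset sg_edge fst sg_terminus sg_reverse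
    sg_reverseK sg_reverse_neq (fun=> erefl).

Definition schreier_base : vertex schreier_graph := coset_of 1.

End SchreierGraph.

(* The graph is connected, so that any base-vertex would do. *)
Definition schreier_amenable (R : realType) (G : groupType) (H : set G)
    (A : finType) (pi : A -> G) : Prop :=
  amenable R (schreier_base H pi).

(* Main.v *)
Require Import Defs.
From mathcomp Require Import all_boot all_order all_algebra finmap.
From mathcomp Require Import all_classical all_reals all_analysis.
From mathcomp Require Import zify ring lra.

(* Let K1 be the set of the g in G1 with phi(g) in Kbar: a subgroup of infinite
   index in G that contains H.  The partial algorithm answers "no" on the words
   with value outside K1 and never answers on the others.  The cosets of G1 form
   a permutation automaton; with the Schreier generators of G1, mapped to Gbar,
   it rewrites a word of G into a word of the same length, so that a machine for
   Kbar can be run on the rewritten word without storing it, with no more space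
   and with 2n + 2 additional steps.  A machine for Kbar has to read its whole
   input (MP_time_ge), hence the additional steps are within the bounds.

   It remains to see that K1 is negligible.  Let T be the adjacency operator on
   the coset graph and d the degree: T^n delta(o), taken at the base-vertex o,
   counts the words of length n with value in K1.  For f_n = T^n delta / d^n the
   sequence |f_n|^2 decreases, and the gaps bound the energy sum_v (f_n(v) -
   f_n(vg))^2 for g of even length; so f_n takes asymptotically equal values at
   infinitely many vertices, whereas its sum is 1: f_n(o) tends to 0.

   If Gamma(Gbar, Kbar) is non-amenable, exponential decay of T^n delta gives a
   bound |Tf| <= s |f| with s < d for all finitely supported f, that is a lower
   bound of the Dirichlet form by the norm.  Such a bound does not depend on the
   generating set and goes over from Kbar \ Gbar to K1 \ G, which is a finite
   union of translated copies of Kbar \ Gbar; there it implies exponential decay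
   again. *)

Set Implicit Arguments.
Unset Strict Implicit.
Unset Printing Implicit Defensive.

Import Order.TTheory GRing.Theory Num.Theory.
Import numFieldNormedType.Exports.
Local Open Scope classical_set_scope.

(** * Turing machines composed with a permutation automaton *)

Section RunLemmas.
Variables (X : finType) (M : tm X).

Lemma run_halted (w : seq X) ch s t b :
  s <= t -> answer (@run X M w ch s) = Some b -> @run X M w ch t = @run X M w ch s.
Proof.
move=> /subnK <- h; elim: (t - s) => [//|k IH].
by rewrite addSn /= IH /step h.
Qed.

Lemma ends_with_halted_at (w : seq X) ch t b :
  @halted_at X M w ch t -> @ends_with X M w ch b -> answer (@run X M w ch t) = Some b.
Proof.
rewrite /halted_at => h [u hu]; have [tu|ut] := leqP t u; last first.
  by rewrite (run_halted (ltnW ut) hu).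
move: h; case e: (answer _) => [b'|//] _.
by rewrite -hu (run_halted tu e).
Qed.

Lemma run_pos (w : seq X) ch t : cf_pos (@run X M w ch t) <= t.+1.
Proof.
elim: t => [//|t IH] /=; rewrite /step; case: (answer _) => [b|]; first lia.
by case: (tm_delta _ _ _ _) => [[q d] acts] /=; case: d => /=; lia.
Qed.

(** The head starts on cell 1, so in [t] steps it scans no cell beyond [t], which holds the letter
    of index [t - 1]. Equal sizes give the head the same right border. *)
Lemma run_eq_prefix (w w' : seq X) ch t :
  size w = size w' -> (forall p, p < t -> onth w p = onth w' p) ->
  @run X M w ch t = @run X M w' ch t.
Proof.
move=> sww'; elim: t => [//|t IH] e /=; rewrite -IH; last by move=> p pt; apply: e; lia.
have es : input_symbol w (cf_pos (run w ch t)) =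
          input_symbol w' (cf_pos (run w ch t)).
  rewrite /input_symbol; case E: (cf_pos _) => [//|p].
  by apply: (e p); have := run_pos w ch t; rewrite E.
by rewrite /step; case: (answer _) => [//|]; rewrite es /input_move sww'.
Qed.

End RunLemmas.

Lemma write_move_stay (n : nat) (S : Type) (b : S)
    (T : {ffun 'I_n -> tape S}) :
  [ffun j => write_move b (T j) ([ffun k => ([ffun l => Defs.thead (T l)] k, Stay)] j)]
  = T.
Proof. by apply/ffunP => j; rewrite !ffunE; case: (T j). Qed.

(* A permutation automaton emitting one letter per letter read can be simulated
   on a two-way input tape: leaving a cell to the left, the state before that
   cell is recovered by inverting the letter found there, one step later. *)
Section Transducer.
Variables (X Y Q : finType) (next prev : Q -> X -> Q) (lab : Q -> X -> Y).
Variables (q0 : Q) (acc : pred Q).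
Hypothesis nextK : forall q x, prev (next q x) x = q.

Fixpoint rewriting (q : Q) (w : seq X) : seq Y :=
  if w is x :: w' then lab q x :: rewriting (next q x) w' else [::].

Definition final (w : seq X) : Q := foldl next q0 w.

Lemma size_rewriting q w : size (rewriting q w) = size w.
Proof. by elim: w q => //= x w IH q; rewrite IH. Qed.

Lemma onth_rewriting q w p :
  onth (rewriting q w) p = omap (lab (foldl next q (take p w))) (onth w p).
Proof. by elim: w q p => [|x w IH] q [|p] //=; apply: IH. Qed.

Variable M : tm Y.

(** Four phases: computing the final state, returning to the left end, simulating [M], rejecting. In
    the third, [pend] records a left move just made, after which the stored state still has to be
    carried back across the letter now scanned. *)
Definition sim_state : finType :=
  (Q + unit + (Q * bool * tm_state M + unit))%type.
Definition Scan q : sim_state := inl (inl q).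
Definition Back : sim_state := inl (inr tt).
Definition Sim q pend s : sim_state := inr (inl (q, pend, s)).
Definition Reject : sim_state := inr (inr tt).

(** When [M] accepts, no answer is given and [sim_delta] idles forever: membership in a larger
    subgroup does not decide membership in a smaller one. *)
Definition sim_out (s : sim_state) : option bool :=
  match s with
  | inr (inl (_, _, s)) => if tm_out s is Some false then Some false else None
  | inr (inr _) => Some false
  | _ => None
  end.

Definition resolve (q : Q) (pend : bool) (x : option X) : Q :=
  if x is Some x then if pend then prev q x else q else q.

Lemma resolve_false q x : resolve q false x = q. Proof. by case: x. Qed.

Definition sim_delta (s : sim_state) (x : option X)
    (tp : {ffun 'I_(tm_tapes M) -> tm_sym M}) (i : 'I_(tm_branch M).+1) :
    sim_state * dir * {ffun 'I_(tm_tapes M) -> tm_sym M * dir} :=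
  let keep := [ffun j => (tp j, Stay)] in
  match s with
  | inl (inl q) =>
      if x is Some x then (Scan (next q x), Right, keep)
      else if acc q then (Back, Left, keep) else (Reject, Stay, keep)
  | inl (inr _) =>
      if x is Some x then (Back, Left, keep)
      else (Sim q0 false (tm_start M), Right, keep)
  | inr (inl (q, pend, s)) =>
      if tm_out s is Some _ then (Sim q pend s, Stay, keep) else
      let q1 := resolve q pend x in
      let: (s', d, acts) := tm_delta s (omap (lab q1) x) tp i in
      (match d with
       | Left => Sim q1 true s'
       | Stay => Sim q1 false s'
       | Right => Sim (if x is Some x then next q1 x else q1) false s'
       end, d, acts)
  | inr (inr _) => (Reject, Stay, keep)
  end.

Definition sim_tm : tm X :=
  @TM X sim_state (tm_sym M) (tm_blank M) (tm_tapes M) (tm_branch M)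
    (Scan q0) sim_out sim_delta.

Section Word.
Variables (w : seq X) (ch : nat -> 'I_(tm_branch M).+1).
Let v := rewriting q0 w.
Let run' t := @run X sim_tm w ch t.

Let run'S t : run' t.+1 = @step X sim_tm w (ch t) (run' t). Proof. by []. Qed.

Let T0 : {ffun 'I_(tm_tapes M) -> tape (tm_sym M)} :=
  [ffun=> Tape [::] (tm_blank M) [::]].

Lemma run_scan t : t <= size w ->
  run' t = @Config X sim_tm (Scan (foldl next q0 (take t w))) t.+1
             T0.
Proof.
elim: t => [|t IH] tw; first by rewrite take0.
rewrite run'S IH; last lia.
rewrite /step /answer /=.
have [x wt] : exists x, onth w t = Some x.
  by move: tw; rewrite -onthTE; case: onth => // x _; exists x.
rewrite wt /= write_move_stay.
by rewrite (take_nth x) // foldl_rcons (onth_nth _ _ _ _ wt); congr Config; lia.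
Qed.

Lemma run_reject t : ~~ acc (final w) -> size w < t ->
  run' t = @Config X sim_tm Reject (size w).+1 T0.
Proof.
move=> nacc /subnK <-; elim: (t - _) => [|k IH]; last first.
  by rewrite addSn run'S IH /step.
rewrite add0n run'S run_scan // take_size.
rewrite /step /answer /= onth_default //.
by rewrite -/(final w) (negbTE nacc) /= write_move_stay.
Qed.

Hypothesis wacc : acc (final w).

Lemma run_back k : k <= size w ->
  run' ((size w).+1 + k) =
  @Config X sim_tm Back (size w - k) T0.
Proof.
elim: k => [|k IH] kw.
  rewrite addn0 subn0 run'S run_scan // take_size.
  by rewrite /step /answer /= onth_default // -/(final w) wacc /= write_move_stay.
rewrite addnS run'S IH; last lia.
rewrite /step /answer /=.
have -> : size w - k = (size w - k.+1).+1 by lia.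
have /= : onth w (size w - k.+1) by rewrite onthTE; lia.
by case: onth => //= x _; rewrite write_move_stay.
Qed.

(** [size w] steps to the right end, one to test [acc], [size w] more to reach cell 0, and one to
    enter cell 1. *)
Definition sim_start := (size w).*2.+2.

(** The automaton state just before cell [p]. Cells 0 and 1 share the state [q0], in accordance with
    [resolve], which changes nothing on a blank. *)
Let cst p := foldl next q0 (take p.-1 w).
Let chv t := ch (sim_start + t).

Lemma input_symbol_rewriting p :
  input_symbol v p = omap (lab (cst p)) (input_symbol w p).
Proof. by case: p => [//|p]; rewrite /= onth_rewriting. Qed.

Lemma cst_next p :
  cst (minn p.+1 (size w).+1) =
  if input_symbol w p is Some x then next (cst p) x else cst p.
Proof.
case: p => [|p] /=; first by rewrite /cst; congr foldl; case: (size w) => //; lia.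
case e: onth => [x|]; last first.
  move: (onthTE w p); rewrite e /= => /esym/negbT; rewrite -leqNgt => sp.
  by rewrite /cst (minn_idPr _) /= ?take_oversize //; lia.
have pw : p < size w by rewrite -onthTE e.
rewrite (minn_idPl _); last lia.
by rewrite /cst /= (take_nth x) // foldl_rcons (onth_nth _ _ _ _ e).
Qed.

Lemma cst_prev p : p <= (size w).+1 ->
  resolve (cst p) true (input_symbol w p.-1) = cst p.-1.
Proof.
case: p => [//|p] pw /=; have := cst_next p; rewrite (minn_idPl _) // => ->.
case: p pw => [//|p] pw /=.
by move: (onthTE w p); case: onth => [x _|/=]; [rewrite /= nextK | lia].
Qed.

(** Invariant of the simulation. The stored state agrees with the state before the scanned cell only
    after [resolve], since a left move postpones its correction by one step. *)
Lemma run_sim t : exists q pend, let c := @run Y M v chv t in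
  [/\ run' (sim_start + t) =
        @Config X sim_tm (Sim q pend (cf_state c)) (cf_pos c) (cf_tapes c),
      resolve q pend (input_symbol w (cf_pos c)) = cst (cf_pos c) &
      cf_pos c <= (size w).+1].
Proof.
elim: t => [|t [q [pend /= [IH rs ps]]]].
  exists q0, false; split=> //=; last first.
    by rewrite resolve_false /cst take0.
  rewrite addn0 /sim_start -addnn -addSn run'S run_back // subnn.
  rewrite /step /answer /= write_move_stay.
  by have -> : minn 1 (size w).+1 = 1 by lia.
rewrite addnS run'S IH.
set c := run v chv t in IH rs ps *.
rewrite /step /answer /=.
case eo: (tm_out (cf_state c)) => [[]|].
- by exists q, pend; rewrite /= write_move_stay.
- by exists q, pend.
rewrite rs input_symbol_rewriting.
case: (tm_delta _ _ _ _) => [[s' d] acts].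
case: d => /=.
- exists (cst (cf_pos c)), true; split=> //; last lia.
  exact: cst_prev.
- exists (cst (cf_pos c)), false; split=> //.
  exact: resolve_false.
- exists (cst (minn (cf_pos c).+1 (size w).+1)), false; split=> //.
  + by rewrite cst_next /input_move size_rewriting; case: input_symbol.
  + by rewrite resolve_false /input_move size_rewriting.
  + by rewrite /input_move size_rewriting; lia.
Qed.

Lemma answer_sim t :
  answer (run' (sim_start + t)) =
  if answer (@run Y M v chv t) is Some false then Some false else None.
Proof. by have [q [pend [-> _ _]]] := run_sim t. Qed.
End Word.

(** Before the simulation phase and on rejection the work tapes are untouched, as those of [M] at
    time 0. Hence space bounds carry over without any constant. *)
Lemma sim_tapes (w : seq X) ch t : exists ch' u,
  cf_tapes (@run X sim_tm w ch t) =
  cf_tapes (@run Y M (rewriting q0 w) ch' u).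
Proof.
have [tw|wt] := leqP t (size w); first by exists ch, 0; rewrite run_scan.
have [wacc|nacc] := boolP (acc (final w)); last by exists ch, 0; rewrite run_reject.
have [ts|st] := ltnP t (sim_start w).
  exists ch, 0; rewrite -(subnKC wt) run_back //.
  by move: ts wt; rewrite /sim_start; lia.
exists (fun t => ch (sim_start w + t)), (t - sim_start w).
by rewrite -{1}(subnKC st); have [q [pend [-> _ _]]] := run_sim ch wacc (t - sim_start w).
Qed.

Lemma within_space_sim (w : seq X) m :
  @within_space Y M (rewriting q0 w) m -> @within_space X sim_tm w m.
Proof.
move=> sp ch t; have [ch' [u e]] := sim_tapes w ch t.
have := sp ch' u.
by congr (_ <= _); apply: eq_bigr => j _; rewrite -e.
Qed.

Lemma sim_never_accepts (w : seq X) ch : ~ @ends_with X sim_tm w ch true.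
Proof.
by case=> t; rewrite /answer /=; case: (cf_state _) => [[]//|[[[q p] s]|]//=];
  case: (tm_out s) => [[]|].
Qed.

Lemma sim_rejects (w : seq X) ch u :
  (acc (final w) ->
   answer (@run Y M (rewriting q0 w) (fun t => ch (sim_start w + t)) u) = Some false) ->
  answer (@run X sim_tm w ch (sim_start w + u)) = Some false.
Proof.
have [wacc|nacc _] := boolP (acc (final w)).
  by move=> /(_ isT) h; rewrite answer_sim // h.
by rewrite run_reject // /sim_start; lia.
Qed.

(** As the machine never accepts, only a rejection of some [w] in [L] has to be excluded. [M]
    accepts the rewritten word along some [ch], and delaying [ch] by [sim_start w] gives a
    computation that never answers. *)
Lemma sim_correct (L : set (seq X)) (L' : set (seq Y)) :
  correct_for M L' -> (forall w, exists b, @reaches_decision Y M w b) ->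
  (forall w, L w -> acc (final w) /\ L' (rewriting q0 w)) ->
  correct_for sim_tm L.
Proof.
move=> cM dM sL w [] /=; first by case=> ch /sim_never_accepts.
move=> rej /sL[wacc Lw].
have [[] db] := dM (rewriting q0 w); last by have := cM _ _ db.
case: db => ch [u yes].
pose ch' t := ch (t - sim_start w).
have [t no] := rej ch'.
have chE : (fun t => ch' (sim_start w + t)) = ch.
  by apply: boolp.funext => k; rewrite /ch' addKn.
have := answer_sim ch' wacc (t + u).
rewrite chE (run_halted _ yes) ?leq_addl // yes.
have tt : t <= sim_start w + (t + u) by lia.
by rewrite (run_halted tt no) no.
Qed.

Lemma sim_halts (C : complexity_class) (L' : set (seq Y)) :
  correct_for M L' -> decides_on C M setT ->
  (forall f, (forall w, @within_time Y M w (f (size w))) -> forall n, n <= f n) ->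
  decides_on C sim_tm
    [set w | ~ (acc (final w) /\ L' (rewriting q0 w))].
Proof.
move=> cM [dM rM] fn.
(* On such a word [M] cannot decide yes, being correct, so all its computations reject. *)
have rej w ch : ~ (acc (final w) /\ L' (rewriting q0 w)) -> acc (final w) ->
    @ends_with Y M (rewriting q0 w) ch false.
  move=> Sw wacc; have [_ [[] db]] := dM (rewriting q0 w) Logic.I; last exact: db.
  by case: Sw; split=> //; exact: (cM _ _ db).
have dS w : ~ (acc (final w) /\ L' (rewriting q0 w)) ->
    forall ch, @ends_with X sim_tm w ch false.
  move=> Sw ch.
  have [wacc|nacc] := boolP (acc (final w)).
    have [u hu] := rej w (fun t => ch (sim_start w + t)) Sw wacc.
    by exists (sim_start w + u); apply: sim_rejects.
  by exists (sim_start w + 0); apply: sim_rejects => /(negP nacc).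
have time F : time_bounded F M setT -> time_bounded F sim_tm
    [set w | ~ (acc (final w) /\ L' (rewriting q0 w))].
  move=> [f Ff tf].
  have {}tf w : @within_time Y M w (f (size w)) by apply: tf.
  (* Since [n <= f n] and [f] is monotone, the total time [2 * n + 2 + f n] is at most
     [3 * f (5 * n + 5) + 2]. *)
  exists (fun n => 5 * f (5 * n + 5) + 5); first exact: bounds_closed.
  move=> w Sw ch.
  have tw : sim_start w + f (size w) <= 5 * f (5 * size w + 5) + 5.
    have := fn f tf (size w); have [mono _] := bounds_proper Ff.
    have := mono (size w) (5 * size w + 5); rewrite /sim_start; lia.
  have aw : answer (@run X sim_tm w ch (sim_start w + f (size w))) = Some false.
    apply: sim_rejects => wacc; apply: ends_with_halted_at; last exact: rej.
    by have := tf (rewriting q0 w); rewrite size_rewriting; apply.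
  by rewrite /halted_at (run_halted tw aw) aw.
have space F : space_bounded F M setT -> space_bounded F sim_tm
    [set w | ~ (acc (final w) /\ L' (rewriting q0 w))].
  move=> [f Ff sf]; exists f => // w Sw; apply: within_space_sim.
  by rewrite -(size_rewriting q0); apply: sf.
split.
  move=> w Sw; split; last by exists false; apply: dS.
  by move=> ch; have [t ht] := dS w Sw ch; exists t; rewrite /halted_at ht.
move: rM; rewrite /resource_bounded; case: (class_resources C) => [F|F|F F'].
- exact: time.
- exact: space.
- by move=> [/time ? /space ?].
Qed.

End Transducer.

Local Open Scope group_scope.

(** * Reidemeister-Schreier rewriting *)

Section GroupLemmas.
Variable G : groupType.
Implicit Types K S T : set G.

Lemma subgroup_generated S : subgroup (generated S).
Proof.
split=> [T [[T1 TM TV] _] //|x y Sx Sy T sT|x Sx T sT].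
  by have [[_ TM _] _] := sT; apply: TM; [apply: Sx | apply: Sy].
by have [[_ _ TV] _] := sT; apply: TV; apply: Sx.
Qed.

Lemma generating_ind (A : finType) (pi : A -> G) T :
  generating pi -> subgroup T -> (forall a, T (pi a)) -> forall g, T g.
Proof.
move=> gA sT TA g; have : generated (range pi) g by rewrite gA.
by apply; split=> // _ [a _ <-].
Qed.

Lemma subgroup_letter (A : finType) (pi : A -> G) K x :
  subgroup K -> (forall a, K (pi a)) -> K (letter_val pi x).
Proof. by case=> _ _ KV KA; case: x => a //=; apply: KV. Qed.

Section Words.
Variables (A : finType) (pi : A -> G).

Lemma word_val_nil : word_val pi [::] = 1.
Proof. by rewrite /word_val big_nil. Qed.

Lemma word_val_cons x w : word_val pi (x :: w) = letter_val pi x * word_val pi w.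
Proof. by rewrite /word_val big_cons. Qed.

Lemma word_val_cat w w' : word_val pi (w ++ w') = word_val pi w * word_val pi w'.
Proof. by rewrite /word_val big_cat. Qed.

Lemma word_val_rcons w x : word_val pi (rcons w x) = word_val pi w * letter_val pi x.
Proof. by rewrite -cats1 word_val_cat word_val_cons word_val_nil mulg1. Qed.

Lemma letter_val_inv x : letter_val pi (letter_inv x) = (letter_val pi x)^-1.
Proof. by case: x => a //=; rewrite invgK. Qed.

Lemma letter_invK : involutive (@letter_inv A).
Proof. by case. Qed.

Lemma word_val_inv w :
  word_val pi (rev [seq letter_inv x | x <- w]) = (word_val pi w)^-1.
Proof.
elim: w => [|x w IH]; first by rewrite word_val_nil invg1.
by rewrite /= rev_cons word_val_rcons IH letter_val_inv word_val_cons invgM.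
Qed.

Lemma word_val_subgroup K w :
  subgroup K -> (forall a, K (pi a)) -> K (word_val pi w).
Proof.
move=> sK KA; have [K1 KM _] := sK.
elim: w => [|x w IH]; first by rewrite word_val_nil.
by rewrite word_val_cons; apply: KM => //; apply: subgroup_letter.
Qed.

Lemma word_val_surj : generating pi -> forall g, exists w, word_val pi w = g.
Proof.
move=> gA; apply: (generating_ind gA) => [|a].
  split; first by exists [::]; rewrite word_val_nil.
    by move=> _ _ [w <-] [w' <-]; exists (w ++ w'); rewrite word_val_cat.
  by move=> _ [w <-]; eexists; apply: word_val_inv.
by exists [:: inl a]; rewrite word_val_cons word_val_nil mulg1.
Qed.

End Words.

Lemma right_coset_eq K g h : subgroup K ->
  right_coset K g = right_coset K h <-> K (g * h^-1).
Proof.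
move=> [K1 KM KV]; split=> [e|Kgh].
  have : right_coset K h g by rewrite -e; exists 1 => //; rewrite mul1g.
  by case=> k Kk <-; rewrite mulgK.
apply/seteqP; split=> _ [k Kk <-].
  by exists (k * (g * h^-1)); [exact: KM|rewrite -!mulgA mulVg mulg1].
exists (k * (g * h^-1)^-1); first by apply: KM => //; apply: KV.
by rewrite invgM invgK -!mulgA mulVg mulg1.
Qed.

Lemma infinite_index_proper K : infinite_index K -> K <> setT.
Proof.
move=> iK KT; apply: iK; apply: (@sub_finite_set _ _ [set setT]) => //.
move=> _ [g _ <-]; rewrite KT /=; apply/seteqP; split=> // x _.
by exists (x * g^-1) => //; rewrite -mulgA mulVg mulg1.
Qed.

End GroupLemmas.

Section Preimage.
Variables (G G' : groupType) (G1 : set G) (phi : G -> G') (K : set G').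
Hypotheses (sG1 : subgroup G1) (phiM : morphism_on G1 phi) (sK : subgroup K).

Lemma morph1 : phi 1 = 1.
Proof.
have [G11 _ _] := sG1.
by have := phiM G11 G11; rewrite mulg1 => /(congr1 (fun x => (phi 1)^-1 * x));
  rewrite mulVg mulgA mulVg mul1g.
Qed.

Lemma morphV g : G1 g -> phi g^-1 = (phi g)^-1.
Proof.
have [_ _ G1V] := sG1 => G1g; have := phiM (G1V _ G1g) G1g.
by rewrite mulVg morph1 => e; rewrite -[LHS](mulgK (phi g)) -e mul1g.
Qed.

Definition preimage_on : set G := [set g | G1 g /\ K (phi g)].

Lemma subgroup_preimage_on : subgroup preimage_on.
Proof.
have [G11 G1M G1V] := sG1; have [K1 KM KV] := sK.
split; first by split=> //; rewrite morph1.
  by move=> x y [G1x Kx] [G1y Ky]; split; [exact: G1M|rewrite phiM //; exact: KM].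
by move=> x [G1x Kx]; split; [exact: G1V|rewrite morphV //; exact: KV].
Qed.

(** [F] sends the coset of [g] in [G1] to the coset of [phi g]. As [phi] is onto, every coset of [K]
    is reached, so a finite index would pass down. The intersection with [G1] confines [phi] to
    where it is multiplicative. *)
Lemma infinite_index_preimage_on :
  phi @` G1 = setT -> infinite_index K -> infinite_index preimage_on.
Proof.
move=> onto iK fin; apply: iK.
pose F (V : set G) : set G' := [set k * phi v | k in K & v in (V `&` G1)].
apply: (@sub_finite_set _ _ (F @` range (right_coset preimage_on))); last exact: finite_image.
move=> _ [y _ <-]; have : (phi @` G1) y by rewrite onto.
case=> g G1g <-; exists (right_coset preimage_on g); first by exists g.
have [G11 G1M G1V] := sG1; have [K1 KM KV] := sK.
apply/seteqP; split=> z.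
  case=> k Kk [v [[h [G1h Kh] <-] _] <-].
  exists (k * phi h); first exact: KM.
  by rewrite phiM // mulgA.
case=> k Kk <-; exists k => //; exists g => //; split=> //; exists 1; last by rewrite mul1g.
by split=> //; rewrite morph1.
Qed.

Lemma preimage_onM g h : G1 g -> G1 h ->
  preimage_on (g * h^-1) <-> K (phi g * (phi h)^-1).
Proof.
move=> G1g G1h; have [_ G1M G1V] := sG1.
rewrite /preimage_on /= phiM ?morphV //; last exact: G1V.
by split=> [[]//|]; split=> //; apply: G1M => //; apply: G1V.
Qed.

End Preimage.

Section Reidemeister_Schreier.
Variables (G G' : groupType) (G1 : set G) (phi : G -> G').
Hypotheses (sG1 : subgroup G1) (phiM : morphism_on G1 phi).
Hypothesis fiG1 : finite_index G1.
Variables (A : finType) (pi : A -> G).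

(** A finite type is required because the cosets serve both as automaton states and as components of
    an alphabet. *)
Definition fcoset : finType := fset_set (range (right_coset G1)).

Lemma right_coset_fset g : right_coset G1 g \in fset_set (range (right_coset G1)).
Proof. by rewrite in_fset_set // inE; exists g. Qed.

Definition fcoset_of (g : G) : fcoset := [` right_coset_fset g]%fset.

Lemma fcoset_ofP g h : fcoset_of g = fcoset_of h <-> G1 (g * h^-1).
Proof.
rewrite -right_coset_eq //; split=> [/(congr1 val)//|e]; exact/val_inj.
Qed.

Lemma fcoset_of_surj q : exists g, fcoset_of g = q.
Proof.
case: q => V VP; have := VP; rewrite in_fset_set // inE => -[g _ e].
by exists g; apply: val_inj.
Qed.

(** The trivial coset is represented by 1, so that rewriting a word with value in [G1] gives exactly
    the [phi]-image of its value, with no correcting factor. *)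
Definition coset_rep (q : fcoset) : G :=
  if q == fcoset_of 1 then 1 else sval (cid (fcoset_of_surj q)).

Lemma coset_repK : cancel coset_rep fcoset_of.
Proof. by move=> q; rewrite /coset_rep; case: eqP => [->//|_]; case: cid. Qed.

Lemma coset_rep1 : coset_rep (fcoset_of 1) = 1.
Proof. by rewrite /coset_rep eqxx. Qed.

Definition fcoset_mul q g := fcoset_of (coset_rep q * g).

Lemma fcoset_mul_of g h : fcoset_mul (fcoset_of g) h = fcoset_of (g * h).
Proof.
apply/fcoset_ofP; rewrite invgM mulgA mulgK.
by apply/fcoset_ofP; rewrite coset_repK.
Qed.

Lemma fcoset_mulK q g : fcoset_mul (fcoset_mul q g) g^-1 = q.
Proof. by rewrite {2}/fcoset_mul fcoset_mul_of mulgK coset_repK. Qed.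

Lemma schreier_in q g : G1 (coset_rep q * g * (coset_rep (fcoset_mul q g))^-1).
Proof. by apply/fcoset_ofP; rewrite coset_repK. Qed.

Definition rs_next q x := fcoset_mul q (letter_val pi x).
Definition rs_prev q x := fcoset_mul q (letter_val pi x)^-1.

(* The letter None, of value 1, is added for the sake of MP_time_ge. *)
Definition schreier_gen (b : option (fcoset * A)) : G' :=
  if b is Some (q, a) then
    phi (coset_rep q * pi a * (coset_rep (fcoset_mul q (pi a)))^-1)
  else 1.

(** The inverse of [a] read at [q] traverses backwards the edge labelled [a] that ends at [q], hence
    the source [fcoset_mul q (pi a)^-1]. *)
Definition rs_letter q (x : A + A) : (option (fcoset * A) + option (fcoset * A))%type :=
  match x with
  | inl a => inl (Some (q, a))
  | inr a => inr (Some (fcoset_mul q (pi a)^-1, a))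
  end.

Lemma rs_nextK q x : rs_prev (rs_next q x) x = q.
Proof. exact: fcoset_mulK. Qed.

Lemma rs_letter_val q x :
  letter_val schreier_gen (rs_letter q x) =
  phi (coset_rep q * letter_val pi x * (coset_rep (rs_next q x))^-1).
Proof.
case: x => a //; rewrite /= /rs_next /=.
rewrite -(morphV sG1 phiM); last exact: schreier_in.
have -> : fcoset_mul (fcoset_mul q (pi a)^-1) (pi a) = q.
  by rewrite -{2}[pi a]invgK fcoset_mulK.
by congr phi; rewrite !invgM !invgK mulgA.
Qed.

Lemma rs_final g w :
  foldl rs_next (fcoset_of g) w = fcoset_of (g * word_val pi w).
Proof.
elim: w g => [|x w IH] g; first by rewrite word_val_nil mulg1.
by rewrite /= /rs_next fcoset_mul_of IH word_val_cons mulgA.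
Qed.

(** The product telescopes: the representative closing one factor cancels the one opening the
    next. *)
Lemma rs_word_val q w :
  word_val schreier_gen (rewriting rs_next rs_letter q w) =
  phi (coset_rep q * word_val pi w * (coset_rep (foldl rs_next q w))^-1).
Proof.
elim: w q => [|x w IH] q.
  by rewrite !word_val_nil /= mulg1 mulgV (morph1 sG1 phiM).
rewrite /= !word_val_cons rs_letter_val IH -phiM; last 2 first.
- exact: schreier_in.
- have := schreier_in (rs_next q x) (word_val pi w); congr (G1 (_ * (coset_rep _)^-1)).
  by rewrite -{2}[rs_next q x]coset_repK rs_final.
by congr phi; rewrite !mulgA mulgVK.
Qed.

Let q0 := fcoset_of 1.

Lemma rs_accept w : G1 (word_val pi w) <-> final rs_next q0 w = q0.
Proof. by rewrite /final rs_final mul1g fcoset_ofP invg1 mulg1. Qed.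

Lemma rs_word_val_accept w : G1 (word_val pi w) ->
  word_val schreier_gen (rewriting rs_next rs_letter q0 w) = phi (word_val pi w).
Proof.
move=> /rs_accept; rewrite /final => e.
by rewrite rs_word_val e coset_rep1 mul1g invg1 mulg1.
Qed.

(** Schreier's lemma pushed through [phi]: a preimage in [G1] is written as a word over [A] and then
    rewritten. *)
Lemma schreier_generating :
  generating pi -> phi @` G1 = setT -> generating schreier_gen.
Proof.
move=> gA onto; apply/seteqP; split=> // y _.
have : (phi @` G1) y by rewrite onto.
case=> g; have [w <-] := word_val_surj gA g => G1w <-.
rewrite -rs_word_val_accept //; apply: word_val_subgroup => [|b].
  exact: subgroup_generated.
by move=> T [_]; apply; exists b.
Qed.

End Reidemeister_Schreier.

(* A machine answering on words of length n in less than n steps does not read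
   the last letter.  As it accepts e ... e, it also accepts e ... e b for every
   generator b. *)
Lemma MP_time_ge (G : groupType) (K : set G) (B : finType) (rho : B -> G) (e : B)
    (M : tm (B + B)%type) (f : nat -> nat) :
  subgroup K -> K <> setT -> generating rho -> rho e = 1 ->
  correct_for M (MP K rho) -> (forall w, exists b, @reaches_decision _ M w b) ->
  (forall w, @within_time _ M w (f (size w))) -> forall n, n <= f n.
Proof.
move=> sK KT gB e1 cM dM tM n; rewrite leqNgt; apply/negP => fn.
apply: KT; apply/seteqP; split=> // g _; apply: (generating_ind gB sK) => {g} b.
have [K1 KM KV] := sK.
pose w0 : seq (B + B) := nseq n.-1 (inl e).
have v0 : word_val rho w0 = 1.
  by rewrite /w0; elim: n.-1 => [|k IH]; rewrite ?word_val_nil //= word_val_cons IH /= e1 mulg1.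
pose w := rcons w0 (inl e); pose w' := rcons w0 (inl b).
have sw : size w = n by rewrite size_rcons size_nseq; lia.
have sw' : size w' = n by rewrite size_rcons size_nseq; lia.
have [[] dw] := dM w; last first.
  by have := cM _ _ dw; rewrite /MP /= word_val_rcons v0 /= e1 mulg1.
have [ch yes] := dw.
have := ends_with_halted_at (tM w ch) yes; rewrite sw => aw.
have : MP K rho w'.
  apply: (cM _ true); exists ch, (f n); rewrite -aw; congr answer.
  apply: run_eq_prefix; first by rewrite sw sw'.
  move=> p pf; rewrite /w /w' -!cats1 !onth_cat size_nseq.
  by have -> : p < n.-1 by lia.
by rewrite /MP /= word_val_rcons v0 mul1g.
Qed.

(** * The partial algorithm for the membership problem of [H] *)

Section Algorithm.
Variables (C : complexity_class) (G G' : groupType) (H G1 : set G).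
Variables (phi : G -> G') (K : set G').
Hypotheses (sG1 : subgroup G1) (fiG1 : finite_index G1) (HG1 : H `<=` G1).
Hypotheses (phiM : morphism_on G1 phi) (phi_onto : phi @` G1 = setT).
Hypotheses (sK : subgroup K) (KT : K <> setT) (HK : phi @` H `<=` K).

(** The trivial coset of [G1] is the start and the only accepting state of the automaton. A word is
    rejected when it ends in another coset or when its rewriting has value outside [K], that is,
    when its value lies outside the preimage of [K], which contains [H]. *)
Lemma partial_algorithm (A : finType) (pi : A -> G) :
  membership_in C K -> generating pi ->
  exists M : tm (A + A)%type, [/\ has_mode (class_mode C) M,
    correct_for M (MP H pi) & decides_on C M (~` MP (preimage_on G1 phi K) pi)].
Proof.
move=> memK gA.
have gB := schreier_generating sG1 phiM fiG1 gA phi_onto.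
have [M [mM cM dM]] := memK _ _ gB.
have nK := @rs_nextK G G1 sG1 fiG1 A pi.
pose q0 := fcoset_of fiG1 1.
exists (sim_tm (rs_next fiG1 pi) (rs_prev fiG1 pi) (rs_letter fiG1 pi) q0 (pred1 q0) M).
split=> //.
- apply: (sim_correct nK cM) => [w|w Hw].
    by have [h _] := dM; have [_] := h w Logic.I.
  have G1w := HG1 Hw; split; first by apply/eqP/(rs_accept sG1 fiG1 pi).
  by rewrite /MP /= rs_word_val_accept //; apply: HK; exists (word_val pi w).
- have -> : ~` MP (preimage_on G1 phi K) pi =
    [set w | ~ (pred1 q0 (final (rs_next fiG1 pi) q0 w) /\
       MP K (schreier_gen phi fiG1 pi)
         (rewriting (rs_next fiG1 pi) (rs_letter fiG1 pi) q0 w))].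
    apply/seteqP; split=> w /= nw h; apply: nw.
      have /(rs_accept sG1 fiG1 pi) G1w := eqP (proj1 h).
      split=> //; rewrite -(rs_word_val_accept sG1 phiM fiG1) //; exact: (proj2 h).
    have [G1w Kw] := h; split; first exact/eqP/(rs_accept sG1 fiG1 pi).
    by rewrite /MP /= rs_word_val_accept.
  apply: sim_halts => // f tf n.
  apply: (MP_time_ge (e := None) sK KT gB _ cM) => // w.
  by have [h _] := dM; have [_] := h w Logic.I.
Qed.

End Algorithm.

Local Open Scope ring_scope.

(** * Finitely supported functions *)

Section FiniteSupport.
Variables (R : realType) (V : choiceType).
Implicit Types f g h : V -> R.

Definition fsupp f : Prop := finite_set (f @^-1` [set~ 0]).

(** This finitary sum is 0 by convention when the support is infinite, hence the hypotheses [fsupp]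
    in additivity and monotonicity. *)
Definition vsum f : R := \sum_(v \in [set: V]) f v.

Lemma fsupp2 f g h : fsupp f -> fsupp g ->
  (forall v, f v = 0 -> g v = 0 -> h v = 0) -> fsupp h.
Proof.
move=> ff fg fgh; apply: (@sub_finite_set _ _ (f @^-1` [set~ 0] `|` g @^-1` [set~ 0])).
  by move=> v /= hv; apply: contra_notP hv => /not_orP[/contrapT fv /contrapT gv]; exact: fgh.
by rewrite finite_setU.
Qed.

Lemma fsupp1 f h : fsupp f -> (forall v, f v = 0 -> h v = 0) -> fsupp h.
Proof. by move=> ff fh; apply: (fsupp2 ff ff) => v /fh. Qed.

Lemma fsupp_sum (I : finType) (F : I -> V -> R) :
  (forall i, fsupp (F i)) -> fsupp (fun v => \sum_i F i v).
Proof.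
move=> fF; apply: (@sub_finite_set _ _ (\bigcup_(i in [set: I]) (F i @^-1` [set~ 0]))).
  move=> v /= hv; apply: contra_notP hv => h; apply: big1 => i _.
  by apply: contra_notP h => Fi; exists i.
by apply: bigcup_finite => // i _; exact: fF.
Qed.

Lemma fsupp0 : fsupp (fun=> 0).
Proof. by apply: (@sub_finite_set _ _ set0) => // v /= []. Qed.

Lemma vsumE (r : seq V) f : uniq r -> (forall v, v \notin r -> f v = 0) ->
  vsum f = \sum_(v <- r) f v.
Proof.
move=> ur fr; rewrite [RHS]fsbig_seq //; apply/esym; apply: fsbig_widen => // v [_ /= /negP].
exact: fr.
Qed.

Lemma fsupp_seq f g : fsupp f -> fsupp g -> exists r : seq V, [/\ uniq r,
  forall v, v \notin r -> f v = 0 & forall v, v \notin r -> g v = 0].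
Proof.
move=> ff fg; have fU : finite_set (f @^-1` [set~ 0] `|` g @^-1` [set~ 0]) by rewrite finite_setU.
exists (fset_set (f @^-1` [set~ 0] `|` g @^-1` [set~ 0])); split=> // v;
  rewrite in_fset_set // notin_setE => /not_orP[/contrapT fv /contrapT gv //].
Qed.

Lemma vsumD f g : fsupp f -> fsupp g ->
  vsum (fun v => f v + g v) = vsum f + vsum g.
Proof.
move=> ff fg; have [r [ur fr gr]] := fsupp_seq ff fg.
rewrite !(vsumE ur) ?big_split // => v vr; by rewrite fr ?gr ?addr0.
Qed.

Lemma vsumZ c f : vsum (fun v => c * f v) = c * vsum f.
Proof. by rewrite /vsum mulr_fsumr. Qed.

Lemma eq_vsum f g : f =1 g -> vsum f = vsum g.
Proof. by move=> fg; apply: eq_fsbigr => v _. Qed.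

Lemma vsum_ge0 f : (forall v, 0 <= f v) -> 0 <= vsum f.
Proof. by move=> f0; apply: fsumr_ge0. Qed.

Lemma vsum_le f g : fsupp f -> fsupp g -> (forall v, f v <= g v) -> vsum f <= vsum g.
Proof.
move=> ff fg fg'; have [r [ur fr gr]] := fsupp_seq ff fg.
by rewrite !(vsumE ur) //; apply: ler_sum => v _.
Qed.

Lemma vsum_term f u : fsupp f -> (forall v, 0 <= f v) -> f u <= vsum f.
Proof.
move=> ff f0; have [r [ur fr _]] := fsupp_seq ff ff; rewrite (vsumE ur) //.
have [ru|/fr ->] := boolP (u \in r); last exact: sumr_ge0.
by rewrite (bigD1_seq u) //= lerDl; apply: sumr_ge0.
Qed.

Lemma vsum_partial f (B : {fset V}) : fsupp f -> (forall v, 0 <= f v) ->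
  \sum_(v <- B) f v <= vsum f.
Proof.
move=> ff f0.
pose g v := if v \in B then f v else 0.
have -> : \sum_(v <- B) f v = vsum g.
  rewrite (@vsumE B) //; last by move=> v /negbTE; rewrite /g => ->.
  by rewrite big_seq [RHS]big_seq; apply: eq_bigr => v vB; rewrite /g vB.
apply: vsum_le => //; last by move=> v; rewrite /g; case: ifP.
by apply: (fsupp1 ff) => v fv; rewrite /g fv; case: ifP.
Qed.

Lemma vsum_sum (I : Type) (r : seq I) (F : I -> V -> R) :
  (forall i, fsupp (F i)) ->
  vsum (fun v => \sum_(i <- r) F i v) = \sum_(i <- r) vsum (F i).
Proof.
move=> fF; have fr (s : seq I) : fsupp (fun v => \sum_(i <- s) F i v).
  elim: s => [|i s IH].
    by apply: (fsupp1 fsupp0) => v _; rewrite big_nil.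
  by apply: (fsupp2 (fF i) IH) => v Fv rv; rewrite big_cons Fv rv addr0.
elim: r => [|i r IH].
  by rewrite big_nil /vsum fsbig1 // => v _; exact: big_nil.
rewrite big_cons -IH -vsumD //.
by apply: eq_vsum => v; rewrite big_cons.
Qed.

Definition delta (u : V) : V -> R := fun v => (v == u)%:R.

Lemma fsupp_delta u : fsupp (delta u).
Proof.
apply: (@sub_finite_set _ _ [set u]) => // v /=; rewrite /delta.
by case: eqP.
Qed.

Lemma vsum_delta u f : vsum (fun v => delta u v * f v) = f u.
Proof.
rewrite (@vsumE [:: u]) ?big_seq1 /delta ?eqxx ?mul1r // => v.
by rewrite inE => /negbTE ->; rewrite mul0r.
Qed.

Definition ip f g : R := vsum (fun v => f v * g v).

Lemma ipC f g : ip f g = ip g f.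
Proof. by apply: eq_vsum => v; rewrite mulrC. Qed.

Lemma fsuppM f g : fsupp f -> fsupp (fun v => f v * g v).
Proof. by move=> ff; apply: (fsupp1 ff) => v ->; rewrite mul0r. Qed.

Lemma fsuppZ c f : fsupp f -> fsupp (fun v => c * f v).
Proof. by move=> ff; apply: (fsupp1 ff) => v ->; rewrite mulr0. Qed.

Lemma fsuppD f g : fsupp f -> fsupp g -> fsupp (fun v => f v + g v).
Proof. by move=> ff fg; apply: (fsupp2 ff fg) => v -> ->; rewrite addr0. Qed.

Lemma ipDr f g h : fsupp f -> ip f (fun v => g v + h v) = ip f g + ip f h.
Proof.
by move=> ff; rewrite -vsumD; [apply: eq_vsum => v; rewrite mulrDr|exact: fsuppM|exact: fsuppM].
Qed.

Lemma ipZr c f g : ip f (fun v => c * g v) = c * ip f g.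
Proof. by rewrite -vsumZ; apply: eq_vsum => v; rewrite mulrCA. Qed.

Lemma ipDl f g h : fsupp f -> ip (fun v => g v + h v) f = ip g f + ip h f.
Proof. by move=> ff; rewrite ipC ipDr // !(ipC f). Qed.

Lemma ipZl c f g : ip (fun v => c * g v) f = c * ip g f.
Proof. by rewrite ipC ipZr ipC. Qed.

Lemma ip_ge0 f : 0 <= ip f f.
Proof. by apply: vsum_ge0 => v; rewrite -expr2 sqr_ge0. Qed.

Lemma ip_comb (a b : R) f g : fsupp f -> fsupp g ->
  ip (fun v => a * f v + b * g v) (fun v => a * f v + b * g v) =
  a ^+ 2 * ip f f + 2 * a * b * ip f g + b ^+ 2 * ip g g.
Proof.
move=> ff fg; rewrite ipDr; last by apply: fsuppD; exact: fsuppZ.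
rewrite !ipDl; try exact: fsuppZ.
by rewrite !ipZr !ipZl (ipC g f); ring.
Qed.

Lemma ip_sqr_term f u : fsupp f -> f u ^+ 2 <= ip f f.
Proof.
move=> ff; rewrite expr2; apply: (@vsum_term (fun v => f v * f v)); first exact: fsuppM.
by move=> v; rewrite -expr2 sqr_ge0.
Qed.

End FiniteSupport.

Section Reindex.
Variables (R : realType) (U V : choiceType).
Implicit Types f : V -> R.

Lemma fsupp_inj (j : U -> V) f : injective j -> fsupp f -> fsupp (f \o j).
Proof.
move=> ij ff; rewrite /fsupp -[_ @^-1` _]/(j @^-1` (f @^-1` [set~ 0])).
by apply: finite_preimage => // x y _ _; exact: ij.
Qed.

Lemma vsum_bij (j : U -> V) f : bijective j -> vsum (f \o j) = vsum f.
Proof. by move=> bj; rewrite /vsum (reindex_fsbigT j). Qed.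

(** Cutting [f] off outside the image of [j] turns sums over [U] into sums over [V], where they can
    be compared pointwise. *)
Let restrict (j : U -> V) f v : R := if v \in range j then f v else 0.

Let restrictE (j : U -> V) f : injective j -> vsum (f \o j) = vsum (restrict j f).
Proof.
move=> ij; rewrite /vsum -(fsbig_image _ j) //; last by move=> x y _ _; exact: ij.
rewrite fsbig_mkcond; apply: eq_fsbigr => v _; rewrite /restrict /patch.
by [].
Qed.

Let fsupp_restrict (j : U -> V) f : fsupp f -> fsupp (restrict j f).
Proof. by move=> ff; apply: (fsupp1 ff) => v fv; rewrite /restrict fv; case: ifP. Qed.

Lemma vsum_inj (j : U -> V) f : injective j -> fsupp f -> (forall v, 0 <= f v) ->
  vsum (f \o j) <= vsum f.
Proof.
move=> ij ff f0; rewrite restrictE //; apply: vsum_le => //; first exact: fsupp_restrict.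
by move=> v; rewrite /restrict; case: ifP.
Qed.

(** Each point of [V] is counted at least once on the right, and overlaps of the images only add
    nonnegative terms. *)
Lemma vsum_cover (I : finType) (j : I -> U -> V) f :
  (forall i, injective (j i)) -> (forall v, exists i u, j i u = v) ->
  fsupp f -> (forall v, 0 <= f v) ->
  vsum f <= \sum_i vsum (f \o j i).
Proof.
move=> ij cov ff f0; under eq_bigr do rewrite restrictE //.
rewrite -vsum_sum; last by move=> i; exact: fsupp_restrict.
apply: vsum_le => //; first by apply: fsupp_sum => i; exact: fsupp_restrict.
move=> v; have [i [u e]] := cov v.
rewrite (bigD1 i) //= {1}/restrict ifT; last by rewrite inE; exists u.
by rewrite lerDl; apply: sumr_ge0 => k _; rewrite /restrict; case: ifP.
Qed.

End Reindex.

(** * Energy and adjacency operator of a group action *)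

Section Action.
Variables (R : realType) (V : choiceType) (G : groupType) (act : V -> G -> V).
Hypothesis actM : forall v g h, act (act v g) h = act v (g * h)%g.
Hypothesis act1 : forall v, act v 1%g = v.
Implicit Types f : V -> R.

Lemma actK g : cancel (act^~ g) (act^~ g^-1%g).
Proof. by move=> v; rewrite actM mulgV act1. Qed.

Lemma actVK g : cancel (act^~ g^-1%g) (act^~ g).
Proof. by move=> v; rewrite actM mulVg act1. Qed.

Definition translate g f : V -> R := fun v => f (act v g).

Lemma fsupp_translate g f : fsupp f -> fsupp (translate g f).
Proof. by apply: fsupp_inj; exact: can_inj (actK g). Qed.

Lemma vsum_translate g f : vsum (translate g f) = vsum f.
Proof. by apply: vsum_bij; exists (act^~ g^-1%g); [exact: actK|exact: actVK]. Qed.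

Lemma ip_translate g f f' : ip (translate g f) f' = ip f (translate g^-1%g f').
Proof.
rewrite /ip -(vsum_translate g (fun v => _ * translate _ _ _)).
by apply: eq_vsum => v; rewrite /translate actK.
Qed.

Definition energy g f : R := vsum (fun v => (f v - f (act v g)) ^+ 2).

Lemma fsupp_energy g f : fsupp f -> fsupp (fun v => (f v - f (act v g)) ^+ 2).
Proof.
move=> ff; apply: (fsupp2 ff (fsupp_translate g ff)) => v.
by rewrite /translate => -> ->; rewrite subrr expr0n.
Qed.

Lemma energy_ge0 g f : 0 <= energy g f.
Proof. by apply: vsum_ge0 => v; exact: sqr_ge0. Qed.

Lemma energy1 f : energy 1 f = 0.
Proof. by rewrite /energy /vsum fsbig1 // => v _; rewrite act1 subrr expr0n. Qed.

Lemma energyV g f : energy g^-1 f = energy g f.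
Proof.
rewrite {1}/energy -(vsum_translate g); apply: eq_vsum => v.
by rewrite /translate actK -sqrrN opprB.
Qed.

(** The difference between [v] and [v g h] passes through [v g]. The inequality
    [(x + y)^2 <= 2 x^2 + 2 y^2] is summed over [v], the second term being a translate of the energy
    of [h]. *)
Lemma energyM g h f : fsupp f ->
  energy (g * h) f <= 2 * energy g f + 2 * energy h f.
Proof.
move=> ff; rewrite -[energy h f](vsum_translate g) /energy -!vsumZ -vsumD; last 2 first.
- by apply: fsuppZ; exact: fsupp_energy.
- by apply: fsuppZ; apply: fsupp_translate; exact: fsupp_energy.
apply: vsum_le; first exact: fsupp_energy.
  by apply: fsuppD; apply: fsuppZ; [|apply: fsupp_translate]; exact: fsupp_energy.
move=> v; rewrite /translate actM.
have := sqr_ge0 (f v - f (act v g) - (f (act v g) - f (act v (g * h)%g))).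
nra.
Qed.

Lemma energyE g f : fsupp f -> energy g f = 2 * ip f f - 2 * ip f (translate g f).
Proof.
move=> ff; have fg := fsupp_translate g ff.
transitivity (ip (fun v => 1 * f v + (-1) * translate g f v) (fun v => 1 * f v + (-1) * translate g f v)).
  by apply: eq_vsum => v; rewrite mul1r mulN1r -expr2.
rewrite ip_comb //; have -> : ip (translate g f) (translate g f) = ip f f.
  by rewrite -[RHS](vsum_translate g).
by ring.
Qed.

Variables (A : finType) (pi : A -> G).

Definition dirichlet f : R := \sum_a energy (pi a) f.

Definition adj f : V -> R := fun v => \sum_(x : A + A) f (act v (letter_val pi x)).

Let d : R := #|{: A + A}|%:R.

Lemma fsupp_adj f : fsupp f -> fsupp (adj f).
Proof. by move=> ff; apply: fsupp_sum => x; exact: fsupp_translate. Qed.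

Lemma fsupp_iter_adj n f : fsupp f -> fsupp (iter n adj f).
Proof. by move=> ff; elim: n => //= n; exact: fsupp_adj. Qed.

Lemma ip_adj_sum f f' : fsupp f' ->
  ip f' (adj f) = \sum_(x : A + A) ip f' (translate (letter_val pi x) f).
Proof.
move=> ff'; rewrite -vsum_sum; last by move=> x; exact: fsuppM.
by apply: eq_vsum => v; rewrite mulr_sumr.
Qed.

(** The adjoint of a translation is the inverse translation, and inversion permutes the letters. *)
Lemma ip_adj f f' : fsupp f -> fsupp f' -> ip (adj f) f' = ip f (adj f').
Proof.
move=> ff ff'; rewrite ipC !ip_adj_sum //.
rewrite (reindex_inj (inv_inj (@letter_invK A))) /=; apply: eq_bigr => x _.
by rewrite letter_val_inv ipC ip_translate invgK.
Qed.

Lemma ip_iter_adj n f f' : fsupp f -> fsupp f' ->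
  ip (iter n adj f) f' = ip f (iter n adj f').
Proof.
elim: n f f' => //= n IH f f' ff ff'; rewrite ip_adj // ?IH //; last first.
- exact: fsupp_iter_adj.
- exact: fsupp_adj.
by rewrite -iterSr.
Qed.

(** A generator contributes twice the norm minus twice an inner product; the latter is shared
    equally by the two letters [inl a] and [inr a]. Thus the form is that of the combinatorial
    Laplacian [d - T]. *)
Lemma dirichletE f : fsupp f -> dirichlet f = d * ip f f - ip f (adj f).
Proof.
move=> ff; rewrite /dirichlet /d card_sum natrD ip_adj_sum // big_sumType /=.
under eq_bigr do rewrite energyE //.
have -> : \sum_(a : A) ip f (translate (pi a)^-1%g f) = \sum_(a : A) ip f (translate (pi a) f).
  by apply: eq_bigr => a _; rewrite -ip_translate ipC.
rewrite sumrB sumr_const -mulr_sumr -[in LHS]mulr_natr; ring.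
Qed.

Lemma adj_ge0 f : (forall v, 0 <= f v) -> forall v, 0 <= adj f v.
Proof. by move=> f0 v; apply: sumr_ge0. Qed.

Lemma adj_le f f' : (forall v, f v <= f' v) -> forall v, adj f v <= adj f' v.
Proof. by move=> h v; apply: ler_sum => x _. Qed.

Lemma iter_adj_ge0 n f : (forall v, 0 <= f v) -> forall v, 0 <= iter n adj f v.
Proof. by move=> f0; elim: n => //= n IH v; exact: adj_ge0. Qed.

Lemma iter_adj_le n f f' : (forall v, f v <= f' v) ->
  forall v, iter n adj f v <= iter n adj f' v.
Proof. by move=> h; elim: n => //= n IH v; exact: adj_le. Qed.

Lemma adj_comb a b f f' :
  adj (fun v => a * f v + b * f' v) = (fun v => a * adj f v + b * adj f' v).
Proof. by apply/funext => v; rewrite /adj !mulr_sumr -big_split. Qed.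

Lemma iter_adj_comb n a b f f' :
  iter n adj (fun v => a * f v + b * f' v) =
  (fun v => a * iter n adj f v + b * iter n adj f' v).
Proof. by elim: n => //= n ->; rewrite adj_comb. Qed.

Lemma vsum_adj f : fsupp f -> vsum (adj f) = d * vsum f.
Proof.
move=> ff; rewrite vsum_sum; last by move=> x; exact: fsupp_translate.
under eq_bigr do rewrite vsum_translate.
by rewrite sumr_const -[LHS]mulr_natl.
Qed.

(** The elements admitting such a constant form a subgroup, by [energyM] and [energyV], and include
    the generators. This makes spectral gaps independent of the generating set. *)
Lemma energy_le_dirichlet : generating pi ->
  forall g, exists2 c : R, 0 <= c & forall f, fsupp f -> energy g f <= c * dirichlet f.
Proof.
move=> gA.
have D0 f : 0 <= dirichlet f by apply: sumr_ge0 => a _; exact: energy_ge0.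
apply: (generating_ind gA) => [|a]; last first.
  exists 1 => // f ff; rewrite mul1r /dirichlet (bigD1 a) //= lerDl.
  by apply: sumr_ge0 => b _; exact: energy_ge0.
split.
- by exists 0 => // f _; rewrite energy1 mul0r.
- move=> g h [c c0 cg] [c' c'0 ch]; exists (2 * c + 2 * c'); first by lra.
  move=> f ff; apply: (le_trans (energyM g h ff)).
  have := cg f ff; have := ch f ff; lra.
- by move=> g [c c0 cg]; exists c => // f ff; rewrite energyV; exact: cg.
Qed.

End Action.

(** * Spectral gap and exponential decay *)

Lemma convex_bounded_le (R : realType) (u : nat -> R) (C : R) :
  (forall n, 2 * u n.+1 <= u n + u n.+2) -> (forall n, u n <= C) -> u 1%N <= u 0%N.
Proof.
move=> cu bu; rewrite leNgt; apply/negP => u01.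
(* By convexity no increment is smaller than the first, [e], so [u] grows at least linearly and
   exceeds [C]. *)
set e := u 1%N - u 0%N; have e0 : 0 < e by rewrite subr_gt0.
have inc n : e <= u n.+1 - u n.
  by elim: n => [//|n IH]; apply: (le_trans IH); have := cu n; lra.
have lin n : u 0%N + n%:R * e <= u n.
  by elim: n => [|n IH]; [rewrite mul0r addr0|rewrite -natr1; have := inc n; nra].
set x := (C - u 0%N) / e; have xN : x < (Num.bound `|x|)%:R.
  by apply: le_lt_trans (ler_norm _) _; exact: archi_boundP.
have := lin (Num.bound `|x|); have := bu (Num.bound `|x|).
by move: xN; rewrite {1}/x ltr_pdivrMr //; lra.
Qed.

Section Spectral.
Variables (R : realType) (V : choiceType) (G : groupType) (act : V -> G -> V).
Hypothesis actM : forall v g h, act (act v g) h = act v (g * h)%g.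
Hypothesis act1 : forall v, act v 1%g = v.
Variables (A : finType) (pi : A -> G).
Hypothesis gA : generating pi.
Implicit Types f : V -> R.

Let T := @adj R V G act A pi.
Let d : R := #|{: A + A}|%:R.

Variable o : V.
Hypothesis trans : forall v, exists g, v = act o g.

Let fT n f : fsupp f -> fsupp (iter n T f).
Proof. exact: (fsupp_iter_adj actM act1). Qed.

Section Decay_gap.
Variables (s C : R).
Hypothesis s0 : 0 < s.
Hypothesis decay : forall n, iter n T (delta R o) o <= C * s ^+ n.

(** The norm of [T^n f] is [O(s^n)]. The constant [K] may depend on [f]; [decay_adj_bound] removes
    this dependence. *)
Let good f := exists K : R, forall n, ip (iter n T f) (iter n T f) <= K * (s ^+ 2) ^+ n.

Let good_comb a b f f' : fsupp f -> fsupp f' -> good f -> good f' ->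
  good (fun v => a * f v + b * f' v).
Proof.
move=> ff ff' [K hK] [K' hK']; exists (2 * a ^+ 2 * K + 2 * b ^+ 2 * K') => n.
rewrite (iter_adj_comb act pi).
have f1 := fT n ff; have f2 := fT n ff'.
have := ip_ge0 (fun v => a * iter n T f v + (- b) * iter n T f' v).
rewrite !ip_comb //; have := hK n; have := hK' n.
have := sqr_ge0 a; have := sqr_ge0 b.
set S := (s ^+ 2) ^+ n; nra.
Qed.

Let good_le f f' : fsupp f -> fsupp f' -> (forall v, 0 <= f v) ->
  (forall v, f v <= f' v) -> good f' -> good f.
Proof.
move=> ff ff' f0 fle [K hK]; exists K => n; apply: le_trans (hK n).
apply: vsum_le; try by apply: fsuppM; exact: fT.
move=> v; apply: ler_pM; try exact: iter_adj_ge0; exact: iter_adj_le.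
Qed.

Let good_adj f : good f -> good (T f).
Proof.
move=> [K hK]; exists (K * s ^+ 2) => n; rewrite -iterSr.
by apply: (le_trans (hK n.+1)); rewrite exprS mulrA.
Qed.

(** By self-adjointness the squared norm of [T^n delta] is the value of [T^(2n) delta] at [o]. *)
Let good_base : good (delta R o).
Proof.
exists C => n; rewrite (ip_iter_adj actM act1); last 2 first.
- exact: fsupp_delta.
- by apply: fT; exact: fsupp_delta.
by rewrite -iterD /ip vsum_delta; apply: (le_trans (decay _)); rewrite -exprM mul2n addnn.
Qed.

(** The delta at a neighbour of [u] is dominated by [T] applied to the delta at [u], so goodness
    passes along edges in both directions and reaches every vertex by transitivity. *)
Let good_delta v : good (delta R v).
Proof.
have [g ->] := trans v.
pose S := [set g | forall u, good (delta R u) <-> good (delta R (act u g))].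
suff : S g by move=> Sg; exact: (proj1 (Sg o) good_base).
have step u x : good (delta R u) -> good (delta R (act u (letter_val pi x))).
  move=> /good_adj; apply: good_le.
  - exact: fsupp_delta.
  - by apply: (fT 1); exact: fsupp_delta.
  - by move=> w; rewrite /delta ler0n.
  - move=> w; rewrite {1}/delta; case: eqP => [->|_]; last first.
      by apply: adj_ge0 => ?; rewrite /delta ler0n.
    rewrite /T /adj (bigD1 (letter_inv x)) //= letter_val_inv actM mulgV act1.
    by rewrite {1}/delta eqxx lerDl; apply: sumr_ge0 => ? _; rewrite /delta ler0n.
apply: (generating_ind gA) => [|a].
  split.
  - by move=> u; rewrite act1.
  - by move=> h k Sh Sk u; rewrite -actM; exact: (iff_trans (Sh u) (Sk _)).
  - by move=> h Sh u; rewrite (Sh (act u h^-1%g)) actM mulVg act1.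
move=> u; split; first exact: (step u (inl a)).
by move=> /(step _ (inr a)); rewrite /= actM mulgV act1.
Qed.

Let good_all f : fsupp f -> good f.
Proof.
move=> ff; have [r [ur fr _]] := fsupp_seq ff ff.
have -> : f = fun v => \sum_(u <- r) f u * delta R u v.
  apply/funext => v; have [vr|nvr] := boolP (v \in r).
    rewrite (bigD1_seq v) //= /delta eqxx mulr1 big1 ?addr0 // => u uv.
    by rewrite eq_sym (negbTE uv) mulr0.
  rewrite fr // big_seq big1 // => u ur'; rewrite /delta.
  by case: eqP => [e|]; [move: nvr; rewrite e ur'|rewrite mulr0].
elim: r {ur fr} => [|u r IH].
  have -> : (fun v => \sum_(u <- [::]) f u * delta R u v) = (fun v => 0 * delta R o v + 0 * delta R o v).
    by apply/funext => v; rewrite big_nil; ring.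
  by apply: good_comb; try exact: fsupp_delta.
have -> : (fun v => \sum_(w <- u :: r) f w * delta R w v) =
    (fun v => f u * delta R u v + 1 * \sum_(w <- r) f w * delta R w v).
  by apply/funext => v; rewrite big_cons mul1r.
apply: good_comb => //; first exact: fsupp_delta.
elim: r {IH} => [|w r IH].
  by apply: (fsupp1 (fsupp0 R V)) => v _; rewrite big_nil.
apply: (fsupp2 (fsuppZ (f w) (fsupp_delta R w)) IH) => v e1 e2.
by rewrite big_cons e1 e2 addr0.
Qed.

(* The sequence u_n = |T^n f|^2 / s^(2n) is bounded, and it is convex because
   |s^2 T^n f - T^(n+2) f|^2 >= 0; hence u_1 <= u_0. *)
Lemma decay_adj_bound f : fsupp f -> ip (T f) (T f) <= s ^+ 2 * ip f f.
Proof.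
move=> ff; have [K hK] := good_all ff.
have q0 : 0 < s ^+ 2 by rewrite exprn_gt0.
pose u n := ip (iter n T f) (iter n T f) / (s ^+ 2) ^+ n.
have : u 1%N <= u 0%N.
  apply: (@convex_bounded_le _ _ K) => n; last by rewrite ler_pdivrMr ?exprn_gt0.
  have f0 := fT n ff; have f2 := fT n.+2 ff.
  have := ip_ge0 (fun v => s ^+ 2 * iter n T f v + (-1) * iter n.+2 T f v).
  rewrite ip_comb //.
  have -> : ip (iter n T f) (iter n.+2 T f) = ip (iter n.+1 T f) (iter n.+1 T f).
    by rewrite [RHS](ip_adj actM act1) //; apply: (fT n.+1).
  move=> h; rewrite /u -(ler_pM2r (exprn_gt0 n.+2 q0)).
  set a := ip (iter n T f) _ in h *; set b := ip (iter n.+1 T f) _ in h *.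
  set c := ip (iter n.+2 T f) _ in h *; set q := s ^+ 2 in h q0 *.
  have qn : q ^+ n != 0 by rewrite gt_eqF ?exprn_gt0.
  have q1 : q != 0 by rewrite gt_eqF.
  have -> : 2 * (b / q ^+ n.+1) * q ^+ n.+2 = 2 * q * b by rewrite !exprS; field; rewrite qn.
  have -> : (a / q ^+ n + c / q ^+ n.+2) * q ^+ n.+2 = q ^+ 2 * a + c.
    by rewrite !exprS; field; rewrite qn.
  lra.
by rewrite /u expr0 divr1 expr1 ler_pdivrMr //= mulrC.
Qed.

(** Expanding the squared norm of [s f - T f] bounds [ip f (T f)] by [s * ip f f], given the bound
    on the norm of [T f]. *)
Lemma decay_dirichlet f : fsupp f -> (d - s) * ip f f <= dirichlet act pi f.
Proof.
move=> ff; rewrite (dirichletE actM act1) // -/T -/d.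
have := ip_ge0 (fun v => s * f v + (-1) * T f v); rewrite ip_comb //; last exact: (fT 1).
have := decay_adj_bound ff => h1 h2.
have : s * ip f (T f) <= s * (s * ip f f) by lra.
rewrite ler_pM2l //; lra.
Qed.

End Decay_gap.

Section Gap_decay.
Variable eps : R.
Hypothesis eps_d : eps < d.
Hypothesis gap : forall f, fsupp f -> eps * ip f f <= dirichlet act pi f.
Let s := d - eps.
Let s0 : 0 < s. Proof. by rewrite subr_gt0. Qed.

Let form_le f : fsupp f -> ip f (T f) <= s * ip f f.
Proof. by move=> ff; have := gap ff; rewrite (dirichletE actM act1) // -/T -/d /s; lra. Qed.

Let form_ge f : fsupp f -> - (s * ip f f) <= ip f (T f).
Proof.
move=> ff; pose h v := `|f v|.
have fh : fsupp h by apply: (fsupp1 ff) => v; rewrite /h => ->; rewrite normr0.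
have -> : ip f f = ip h h.
  by apply: eq_vsum => v; rewrite /h -normrM ger0_norm // -expr2 sqr_ge0.
apply: (@le_trans _ _ (- ip h (T h))); first by rewrite lerN2 form_le.
rewrite -[X in X <= _]mulN1r -vsumZ; apply: vsum_le; [|exact: fsuppM|].
  by apply: fsuppZ; exact: fsuppM.
move=> v; rewrite mulN1r lerNl; apply: le_trans (ler_norm _) _.
rewrite normrN normrM; apply: ler_wpM2l => //.
exact: ler_norm_sum.
Qed.

(* The form is at most s in absolute value: from below by passing to |f|, since T
   has nonnegative coefficients.  Polarization at s f + T f and s f - T f. *)
Lemma gap_adj_bound f : fsupp f -> ip (T f) (T f) <= s ^+ 2 * ip f f.
Proof.
move=> ff; have fTf : fsupp (T f) by exact: (fT 1).
have fTT : fsupp (T (T f)) by exact: (fT 2).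
have e1 : ip f (T (T f)) = ip (T f) (T f) by rewrite -(ip_adj actM act1).
have key b : ip (fun v => s * f v + b * T f v) (T (fun v => s * f v + b * T f v)) =
    s ^+ 2 * ip f (T f) + 2 * s * b * ip (T f) (T f) + b ^+ 2 * ip (T f) (T (T f)).
  rewrite /T adj_comb -/T ipDl; last by apply: fsuppD; exact: fsuppZ.
  by rewrite !ipDr ?ipZl ?ipZr ?e1; [ring|exact: fsuppZ|exact: fsuppZ].
have := form_le (fsuppD (fsuppZ s ff) (fsuppZ 1 fTf)).
have := form_ge (fsuppD (fsuppZ s ff) (fsuppZ (-1) fTf)).
rewrite !key !ip_comb //.
set a := ip f f; set b := ip (T f) (T f); set c := ip f (T f); set e := ip (T f) (T (T f)).
move=> h1 h2; have : s * b <= s * (s ^+ 2 * a) by lra.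
by rewrite ler_pM2l.
Qed.

(** Iterating [gap_adj_bound] bounds the norm of [T^n delta] by [s^n], and a value at one point is
    at most the norm. *)
Lemma gap_decay n : iter n T (delta R o) o <= s ^+ n.
Proof.
have fd := fsupp_delta R o.
have : ip (iter n T (delta R o)) (iter n T (delta R o)) <= (s ^+ n) ^+ 2.
  elim: n => [|n IH]; first by rewrite /= expr0 expr1n /ip vsum_delta /delta eqxx.
  apply: (le_trans (gap_adj_bound (fT n fd))).
  by rewrite [s ^+ n.+1]exprS exprMn ler_pM2l ?exprn_gt0.
move=> h; have := le_trans (ip_sqr_term o (fT n fd)) h.
rewrite ler_sqr ?nnegrE //; last by rewrite exprn_ge0 // ltW.
by apply: iter_adj_ge0 => v; rewrite /delta ler0n.
Qed.

End Gap_decay.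
End Spectral.

(** * Transfer of a spectral gap between group actions *)

Section Transfer.
Variables (R : realType) (U V : choiceType) (G' G : groupType).
Variables (act' : U -> G' -> U) (act : V -> G -> V).
Hypothesis actM : forall v g h, act (act v g) h = act v (g * h)%g.
Hypothesis act1 : forall v, act v 1%g = v.
Variables (A B : finType) (pi : A -> G) (rho : B -> G').
Hypothesis gA : generating pi.
Variables (I : finType) (j : I -> U -> V).
Hypothesis j_inj : forall i, injective (j i).
Hypothesis j_cover : forall v, exists i u, j i u = v.
Hypothesis j_equivariant : forall i b, exists g, forall u,
  j i (act' u (rho b)) = act (j i u) g.

(** The gap is applied to the restriction of [f] to each copy of [U]. There a generator [b] moves
    points as a single element of [G] does, and the energy of that element is controlled by the
    Dirichlet form on [V]. *)
Lemma dirichlet_transfer (eps : R) : 0 < eps ->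
  (forall f : U -> R, fsupp f -> eps * ip f f <= dirichlet act' rho f) ->
  exists2 eps' : R, 0 < eps' &
    forall f : V -> R, fsupp f -> eps' * ip f f <= dirichlet act pi f.
Proof.
move=> e0 gap.
have /choice[c hc] : forall ib : I * B, exists c : R, 0 <= c /\
    forall f : V -> R, fsupp f ->
      energy act' (rho ib.2) (f \o j ib.1) <= c * dirichlet act pi f.
  move=> [i b] /=.
  have [g jg] := j_equivariant i b.
  have [c c0 cg] := energy_le_dirichlet R actM act1 gA g.
  exists c; split=> // f ff; apply: le_trans (cg f ff).
  rewrite /energy; under eq_vsum do rewrite /= jg.
  apply: (@vsum_inj _ _ _ (j i) (fun v => (f v - f (act v g)) ^+ 2)) => //.
    by apply: (fsupp_energy actM act1).
  by move=> v; exact: sqr_ge0.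
pose K := \sum_ib c ib.
have K0 : 0 <= K by apply: sumr_ge0 => ib _; have [] := hc ib.
(* [K] may vanish, so 1 is added to have a positive denominator. *)
exists (eps / (K + 1)); first by rewrite divr_gt0 // ltr_wpDl.
move=> f ff; rewrite mulrAC ler_pdivrMr ?ltr_wpDl //.
have D0 : 0 <= dirichlet act pi f by apply: sumr_ge0 => a _; exact: energy_ge0.
apply: (@le_trans _ _ (K * dirichlet act pi f)); last by rewrite mulrC ler_wpM2l // lerDl.
apply: (@le_trans _ _ (\sum_i eps * ip (f \o j i) (f \o j i))).
  rewrite -mulr_sumr ler_wpM2l ?(ltW e0) //.
  apply: (@vsum_cover _ _ _ _ _ (fun v => f v * f v)) => //; first exact: fsuppM.
  by move=> v; rewrite -expr2 sqr_ge0.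
have -> : K * dirichlet act pi f = \sum_i \sum_b c (i, b) * dirichlet act pi f.
  by rewrite /K mulr_suml pair_bigA /=; apply: eq_bigr => -[].
apply: ler_sum => i _; apply: (le_trans (gap _ (fsupp_inj (@j_inj i) ff))).
by apply: ler_sum => b _; have [_] := hc (i, b); apply.
Qed.

End Transfer.

(** * Vanishing return probabilities on an infinite transitive action *)

Lemma cvg0Z (R : realType) (c : R) (u : nat -> R) :
  u n @[n --> \oo] --> (0 : R) -> c * u n @[n --> \oo] --> (0 : R).
Proof.
by move=> cu; have := cvgM (cvg_cst c) cu; rewrite mulr0; apply.
Qed.

Lemma cvg0_sum (R : realType) (V : eqType) (r : seq V) (u : V -> nat -> R) :
  (forall v, v \in r -> u v n @[n --> \oo] --> (0 : R)) ->
  \sum_(v <- r) u v n @[n --> \oo] --> (0 : R).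
Proof.
elim: r => [|v r IH] cu.
  by under eq_fun do rewrite big_nil; exact: cvg_cst.
under eq_fun do rewrite big_cons.
have cv := cu v (mem_head v r).
have cr : \sum_(w <- r) u w n @[n --> \oo] --> (0 : R).
  by apply: IH => w wr; apply: cu; rewrite inE wr orbT.
by have := cvgD cv cr; rewrite addr0; apply.
Qed.

Section Null.
Variables (R : realType) (V : choiceType) (G : groupType) (act : V -> G -> V).
Hypothesis actM : forall v g h, act (act v g) h = act v (g * h)%g.
Hypothesis act1 : forall v, act v 1%g = v.
Variables (A : finType) (pi : A -> G) (a0 : A).
Hypothesis gA : generating pi.
Variable o : V.
Hypothesis trans : forall v, exists g, v = act o g.
Hypothesis infV : infinite_set [set: V].

Let T := @adj R V G act A pi.
Let d : R := #|{: A + A}|%:R.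

Let d0 : 0 < d.
Proof. by rewrite /d ltr0n; apply/card_gt0P; exists (inl a0). Qed.

Let P (f : V -> R) : V -> R := fun v => d^-1 * T f v.
(** The distribution of the simple random walk from [o] after [n] steps. *)
Let p n := iter n P (delta R o).

Let fp n : fsupp (p n).
Proof.
elim: n => [|n IH]; first exact: fsupp_delta.
by apply: fsuppZ; apply: (fsupp_adj actM act1).
Qed.

Let p_ge0 n v : 0 <= p n v.
Proof.
elim: n v => [|n IH] v; first by rewrite /= /delta ler0n.
by rewrite /= /P mulr_ge0 ?invr_ge0 ?(ltW d0) //; apply: adj_ge0.
Qed.

Let p_sum n : vsum (p n) = 1.
Proof.
elim: n => [|n IH].
  by rewrite -(vsum_delta o (fun=> 1)); apply: eq_vsum => v; rewrite mulr1.
rewrite /= /P vsumZ (vsum_adj actM act1) // IH mulr1 mulVf // gt_eqF //.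
Qed.

Let a n := ip (p n) (p n).

(** Summing [energyE] over pairs of letters produces [ip (p n) (T (T (p n)))], which is [d^2] times
    the next squared norm by self-adjointness. With single letters the mixed term
    [ip (p n) (T (p n))] would not be such a norm. *)
Let energy2_sum n :
  \sum_x \sum_y energy act (letter_val pi x * letter_val pi y)%g (p n) =
  2 * d ^+ 2 * (a n - a n.+1).
Proof.
have e x y : energy act (letter_val pi x * letter_val pi y)%g (p n) =
    2 * a n - 2 * ip (p n) (translate act (letter_val pi x) (translate act (letter_val pi y) (p n))).
  rewrite energyE //; congr (_ - 2 * _); apply: eq_vsum => v.
  by rewrite /translate actM.
under eq_bigr do (under eq_bigr do rewrite e; rewrite sumrB sumr_const -mulr_sumr).
rewrite sumrB sumr_const -mulr_sumr.
have -> : \sum_x \sum_y ip (p n) (translate act (letter_val pi x) (translate act (letter_val pi y) (p n)))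
    = ip (p n) (T (T (p n))).
  rewrite ip_adj_sum //; apply: eq_bigr => x _.
  rewrite -(vsum_sum _ (F := fun y v => p n v * translate act (letter_val pi x) (translate act (letter_val pi y) (p n)) v)).
    by apply: eq_vsum => v; rewrite -mulr_sumr.
  by move=> y; exact: fsuppM.
have -> : ip (p n) (T (T (p n))) = d ^+ 2 * a n.+1.
  rewrite -(ip_adj actM act1) //; last exact: (fsupp_adj actM act1).
  rewrite /a /= /P ipZl ipZr; field; rewrite gt_eqF //; exact: d0.
rewrite -[X in X - _]mulr_natr -[2 * a n *+ _]mulr_natr -/d.
by ring.
Qed.

Let a_nonincr n : a n.+1 <= a n.
Proof.
have : 0 <= 2 * d ^+ 2 * (a n - a n.+1).
  by rewrite -energy2_sum; do 2 (apply: sumr_ge0 => ? _); exact: energy_ge0.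
by rewrite pmulr_rge0 ?subr_ge0 // mulr_gt0 // exprn_gt0.
Qed.

Let diff_cvg : (a n - a n.+1) @[n --> \oo] --> (0 : R).
Proof.
have ca : cvgn a.
  apply: nonincreasing_is_cvgn; first by apply/nonincreasing_seqP.
  by exists 0 => _ [n _ <-]; exact: ip_ge0.
rewrite -(subrr (limn a)); apply: cvgB => //.
by rewrite (cvg_shiftS a).
Qed.

(** The elements under which the walk is asymptotically invariant. By the two-letter estimate they
    include the values of all words of even length. *)
Let Ev := [set g | energy act g (p n) @[n --> \oo] --> (0 : R)].

Let Ev_subgroup : subgroup Ev.
Proof.
split.
- rewrite /Ev /=; under eq_fun do rewrite (energy1 act1); exact: cvg_cst.
- move=> g h /= cg ch.
  have c2 : (2 * energy act g (p n) + 2 * energy act h (p n)) @[n --> \oo] --> (0 : R).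
    by have := cvgD (cvg0Z 2 cg) (cvg0Z 2 ch); rewrite addr0; apply.
  apply: (squeeze_cvgr _ (cvg_cst 0) c2).
  by near=> n; rewrite energy_ge0 energyM.
- by move=> g /= cg; rewrite /Ev /=; under eq_fun do rewrite (energyV actM act1).
Unshelve. all: by end_near. Qed.

Let Ev_letters x y : Ev (letter_val pi x * letter_val pi y)%g.
Proof.
have c2 : (2 * d ^+ 2 * (a n - a n.+1)) @[n --> \oo] --> (0 : R).
  exact: cvg0Z.
apply: (squeeze_cvgr _ (cvg_cst 0) c2).
near=> n; rewrite energy_ge0 -energy2_sum /=.
rewrite (bigD1 x) //= (bigD1 y) //= -addrA lerDl addr_ge0 //.
  by apply: sumr_ge0 => ? _; exact: energy_ge0.
by do 2 (apply: sumr_ge0 => ? _); exact: energy_ge0.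
Unshelve. all: by end_near. Qed.

Let x0 : A + A := inl a0.

(** Induction on a word for [g]: appending [x0] repairs odd length. *)
Let Ev_index2 g : Ev g \/ Ev (g * letter_val pi x0)%g.
Proof.
have [E1 EM EV] := Ev_subgroup.
have [w <-] := word_val_surj gA g.
elim/last_ind: w => [|w x [IH|IH]]; first by left; rewrite word_val_nil.
  by right; rewrite word_val_rcons -mulgA; apply: EM.
left; rewrite word_val_rcons.
have -> : (word_val pi w * letter_val pi x = word_val pi w * letter_val pi x0 *
    (letter_val pi (letter_inv x0) * letter_val pi x))%g.
  by rewrite letter_val_inv mulgA mulgK.
exact: EM.
Qed.

Let infEv : infinite_set [set act o g | g in Ev].
Proof.
move=> fin; apply: infV.
apply: (@sub_finite_set _ _ ([set act o g | g in Ev] `|`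
   (act^~ (letter_val pi x0)^-1%g) @` [set act o g | g in Ev])).
  move=> v _; have [g ->] := trans v; have [Eg|Eg] := Ev_index2 g.
    by left; exists g.
  right; exists (act o (g * letter_val pi x0)%g); first by exists (g * letter_val pi x0)%g.
  by rewrite /= actM mulgK.
by rewrite finite_setU; split=> //; exact: finite_image.
Qed.

(** On the infinite orbit of [o] under [Ev], [p n] asymptotically takes the value [p n o]. With
    total mass 1, this value cannot stay away from 0. *)
Lemma return_probability_cvg0 : p n o @[n --> \oo] --> (0 : R).
Proof.
have pv v : (exists2 g, Ev g & act o g = v) -> (p n o - p n v) @[n --> \oo] --> (0 : R).
  move=> [g Eg <-]; have c0 : Num.sqrt (energy act g (p n)) @[n --> \oo] --> (0 : R).
    rewrite -(sqrtr0 R); apply: continuous_cvg Eg; exact: sqrt_continuous.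
  apply/norm_cvg0P; apply: (squeeze_cvgr _ (cvg_cst 0) c0).
  near=> n; rewrite normr_ge0 /= -sqrtr_sqr ler_wsqrtr //.
  apply: (@vsum_term _ _ (fun v => (p n v - p n (act v g)) ^+ 2)).
    exact: (fsupp_energy actM act1).
  by move=> ?; exact: sqr_ge0.
apply/cvgrPdist_le => e e0.
(* With more than [2 / e] points, whose total deviation from [p n o] is eventually at most 1 and
   whose mass is at most 1, [p n o] is at most [e]. *)
pose N := (Num.bound (2 / e)).
have [B BE NB] := infinite_set_fset N infEv.
have cB : (\sum_(v <- B) (p n o - p n v)) @[n --> \oo] --> (0 : R).
  apply: (@cvg0_sum _ _ _ (fun v n => p n o - p n v)) => v vB; apply: pv.
  by have [g Eg <-] := BE _ vB; exists g.
near=> n.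
rewrite sub0r normrN ger0_norm //.
have h1 : \sum_(v <- B) (p n o - p n v) <= 1.
  near: n; move/cvgrPdist_le: cB => /(_ 1 ltr01); apply: filterS => n.
  by rewrite sub0r normrN => /(le_trans (ler_norm _)).
have h2 : \sum_(v <- B) p n v <= 1 by rewrite -(p_sum n); exact: vsum_partial.
have : #|` B|%:R * p n o <= 2.
  have -> : #|` B|%:R * p n o = \sum_(v <- B) (p n o - p n v) + \sum_(v <- B) p n v.
    by rewrite -big_split /=; under eq_bigr do rewrite subrK;
      rewrite big_const_seq count_predT iter_addr_0 mulr_natl.
  by lra.
have bnd : 2 / e < #|` B|%:R.
  apply: (@lt_le_trans _ _ N%:R); last by rewrite ler_nat.
  by apply: archi_boundP; rewrite divr_ge0 // ltW.
have B0 : 0 < #|` B|%:R :> R by apply: lt_trans bnd; rewrite divr_gt0.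
move=> h; rewrite -(ler_pM2l B0); apply: (le_trans h).
by move: bnd; rewrite ltr_pdivrMr // => /ltW.
Unshelve. all: by end_near. Qed.

Lemma iter_adj_return n : iter n T (delta R o) o = d ^+ n * p n o.
Proof.
suff -> : iter n T (delta R o) = fun v => d ^+ n * p n v by [].
elim: n => [|n IH]; first by apply/funext => v; rewrite mul1r.
apply/funext => v; rewrite /= IH /P /T /adj -mulr_sumr exprS.
rewrite mulrA; congr (_ * _).
by rewrite mulrAC mulfV ?mul1r // gt_eqF.
Qed.

Lemma return_count_cvg0 : iter n T (delta R o) o / d ^+ n @[n --> \oo] --> (0 : R).
Proof.
under eq_fun do rewrite iter_adj_return mulrAC mulfV ?mul1r ?expf_neq0 ?gt_eqF //.
exact: return_probability_cvg0.
Qed.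

End Null.

(** * Counting words *)

Section Counting.
Variable X : finType.
Implicit Types L : set (seq X).

Definition word_count L (n : nat) : nat := #|[pred w : n.-tuple X | `[< L w >]]|.

Definition words_fset L n : {fset seq X} :=
  [fset val w | w in [pred w : n.-tuple X | `[< L w >]]]%fset.

Lemma words_fsetP L n w : reflect (L w /\ size w = n) (w \in words_fset L n).
Proof.
apply: (iffP (imfsetP _ _ _ _)) => [[t /= /asboolP Lt ->]|[Lw /eqP sw]].
  by rewrite size_tuple.
by exists (Tuple sw) => //=; exact/asboolP.
Qed.

Lemma card_words_fset L n : #|` words_fset L n| = word_count L n.
Proof. rewrite card_imfset /=; last exact: val_inj. by rewrite -cardE; exact: eq_card. Qed.

(** The lengths are strictly below [n], so the ball of radius [n] corresponds to [n.+1]. *)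
Definition ball_fset L n : {fset seq X} :=
  (\bigcup_(k <- iota 0 n) words_fset L k)%fset.

Lemma ball_fsetP L n w : reflect (L w /\ (size w < n)%N) (w \in ball_fset L n).
Proof.
apply: (iffP (bigfcupP _ _ _ _)) => [[k]|[Lw sw]].
  by rewrite mem_iota andbT add0n => /= kn /words_fsetP[Lw ->].
by exists (size w); [rewrite mem_iota add0n sw|exact/words_fsetP].
Qed.

Lemma card_ball_fset L n : #|` ball_fset L n| = (\sum_(k < n) word_count L k)%N.
Proof.
elim: n => [|n IH]; first by rewrite /ball_fset big_nil cardfs0 big_ord0.
have -> : ball_fset L n.+1 = (ball_fset L n `|` words_fset L n)%fset.
  apply/fsetP => w; rewrite in_fsetU; apply/ball_fsetP/orP.
    rewrite ltnS leq_eqVlt => -[Lw /orP[/eqP|] sw]; [right|left].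
      exact/words_fsetP.
    exact/ball_fsetP.
  by case=> [/ball_fsetP|/words_fsetP] [Lw sw]; split=> //; lia.
rewrite cardfsU (_ : (ball_fset L n `&` words_fset L n)%fset = fset0); last first.
  apply/fsetP => w; rewrite in_fsetI in_fset0; apply/negP => /andP[].
  by move=> /ball_fsetP[_ ?] /words_fsetP[_ ?]; lia.
by rewrite cardfs0 subn0 IH card_words_fset big_ord_recr.
Qed.

Lemma card_ball_set L n : #|` fset_set (L `&` @word_ball X n)| =
  (\sum_(k < n.+1) word_count L k)%N.
Proof.
rewrite -card_ball_fset; congr (#|` _|).
have -> : L `&` @word_ball X n = [set` ball_fset L n.+1].
  apply/seteqP; split=> w /=; first by case=> Lw sw; apply/ball_fsetP.
  by case/ball_fsetP => Lw sw; split.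
exact: set_fsetK.
Qed.

Lemma word_countT n : word_count setT n = (#|X| ^ n)%N.
Proof.
rewrite /word_count -card_tuple; apply: eq_card => w.
by rewrite !inE; apply/asboolP.
Qed.

Lemma word_countC L n : (word_count L n + word_count (~` L) n = #|X| ^ n)%N.
Proof.
rewrite -card_tuple -(cardC [pred w : n.-tuple X | `[< L w >]]); congr addn.
by apply: eq_card => w; rewrite !inE; apply/asboolP/negP => h /asboolP.
Qed.

Lemma word_count_le L n : (word_count L n <= #|X| ^ n)%N.
Proof. by rewrite -(word_countC L) leq_addr. Qed.

Lemma densityE (R : realType) L n : density R L n =
  (\sum_(k < n.+1) (word_count L k)%:R) / (\sum_(k < n.+1) #|X|%:R ^+ k).
Proof.
rewrite /density card_ball_set -[word_ball n]setTI card_ball_set !natr_sum.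
by congr (_ / _); apply: eq_bigr => k _; rewrite word_countT natrX.
Qed.

Section Density.
Variables (R : realType) (L : set (seq X)).
Hypothesis X2 : (1 < #|X|)%N.
Let d : R := #|X|%:R.

Let d2 : 2 <= d. Proof. by rewrite (ler_nat _ 2). Qed.

Let d0 : 0 < d. Proof. by apply: lt_le_trans d2. Qed.

Let D n := \sum_(k < n) d ^+ k.
Let S n := \sum_(k < n) (word_count L k)%:R : R.

Let D_ge n : n%:R <= D n.
Proof.
elim: n => [|n IH]; first by rewrite /D big_ord0.
rewrite /D big_ord_recr /= -natr1 lerD //; apply: exprn_ege1; apply: le_trans d2; by rewrite ler1n.
Qed.

Let D_gt0 n : 0 < D n.+1.
Proof. by apply: lt_le_trans (D_ge _); rewrite ltr0n. Qed.

Lemma densityC n : density R (~` L) n = 1 - S n.+1 / D n.+1.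
Proof.
have DS : D n.+1 = \sum_(k < n.+1) (word_count (~` L) k)%:R + S n.+1.
  rewrite /D /S -big_split /=; apply: eq_bigr => k _.
  by rewrite -natrD addnC word_countC natrX.
have D0 : D n.+1 != 0 by rewrite gt_eqF.
rewrite densityE -/(D n.+1); apply/eqP.
by rewrite eq_sym subr_eq -mulrDl -DS divff.
Qed.

(** A Cesaro argument: if the proportion in spheres tends to 0, so does the proportion in balls. *)
Lemma generic_compl :
  (word_count L n)%:R / d ^+ n @[n --> \oo] --> (0 : R) -> generic R (~` L).
Proof.
move=> cL; rewrite /generic.
under eq_fun do rewrite densityC.
suff c0 : S n.+1 / D n.+1 @[n --> \oo] --> (0 : R).
  by have := cvgB (cvg_cst (1 : R)) c0; rewrite subr0; apply.
apply/cvgrPdist_le => e e0.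
have e20 : 0 < e / 2 by rewrite divr_gt0.
have [N _ hN] : \forall n \near \oo, (word_count L n)%:R <= e / 2 * d ^+ n.
  move/cvgrPdist_le: cL => /(_ _ e20); apply: filterS => n.
  by rewrite sub0r normrN ger0_norm ?divr_ge0 ?exprn_ge0 ?(ltW d0) // ler_pdivrMr ?exprn_gt0.
have SN m : S (N + m) <= S N + e / 2 * D (N + m).
  elim: m => [|m IH].
    by rewrite addn0 lerDl mulr_ge0 ?(ltW e20) //; exact: le_trans (D_ge _).
  rewrite addnS /S /D !big_ord_recr /= -/(S _) -/(D _) mulrDr addrA lerD //.
  by apply: hN; rewrite /= leq_addr.
have S0 : 0 <= S N by exact: sumr_ge0.
(* The lengths below [N] contribute the constant [S N], which is at most [e / 2 * D n.+1] from here
   on because [D n] is at least [n]. *)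
exists (N + Num.bound (S N / (e / 2)))%N => // n /= hn.
rewrite sub0r normrN ger0_norm; last first.
  by rewrite divr_ge0 ?(ltW (D_gt0 _)) //; exact: sumr_ge0.
rewrite ler_pdivrMr //.
have Nn : (N <= n.+1)%N by apply: leq_trans (leq_trans hn (leqnSn _)); exact: leq_addr.
have := SN (n.+1 - N)%N; rewrite subnKC // => h.
have : S N <= e / 2 * D n.+1.
  rewrite mulrC -ler_pdivrMr //.
  apply: le_trans (D_ge n.+1); apply: ltW; apply: (@lt_le_trans _ _ (Num.bound (S N / (e / 2)))%:R).
    by apply: archi_boundP; rewrite divr_ge0 // ltW.
  by rewrite ler_nat; apply: leq_trans (leq_trans hn (leqnSn _)); exact: leq_addl.
lra.
Qed.

Lemma strongly_generic_compl (s : R) : s < d ->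
  (forall n, (word_count L n)%:R <= s ^+ n) ->
  generic R (~` L) -> strongly_generic R (~` L).
Proof.
move=> sd hs gL; split=> //.
have s0 : 0 <= s by rewrite -[s]expr1; apply: le_trans (hs 1%N).
(* As [d >= 2], this rate is at least [3 / 2], which makes the sum of [t^k] over [k < m] at most
   [2 * t^m]. Dividing by [D n.+1 >= d^n] gives the constants [t / d] and [2 * t]. *)
have d2' := d2; pose t := Num.max s (3 / 4 * d).
have td : t < d by rewrite /t gt_max sd /=; lra.
have t32 : 3 / 2 <= t by rewrite /t le_max; apply/orP; right; lra.
have st : s <= t by rewrite /t le_max lexx.
exists (t / d), (2 * t); split.
- by rewrite divr_ge0 ?ltr_pdivrMr ?mul1r //; lra.
- by lra.
move=> n _; rewrite densityC subKr.
have St m : S m <= 2 * t ^+ m.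
  elim: m => [|m IH]; first by rewrite /S big_ord0 expr0 mulr1 ler0n.
  rewrite /S big_ord_recr /= -/(S m) exprS.
  have : (word_count L m)%:R <= t ^+ m.
    by apply: (le_trans (hs m)); rewrite lerXn2r ?nnegrE //; lra.
  have : 0 <= t ^+ m by apply: exprn_ge0; lra.
  nra.
rewrite ler_pdivrMr //; apply: (le_trans (St _)).
rewrite exprS mulrA -[leRHS]mulrA ler_wpM2l //; first lra.
rewrite expr_div_n -mulrA ler_peMr //; first by apply: exprn_ge0; lra.
rewrite mulrC ler_pdivlMr ?exprn_gt0 // mul1r /D big_ord_recr /= lerDr.
by apply: sumr_ge0 => k _; rewrite exprn_ge0 // ltW.
Qed.

End Density.
End Counting.

(** * Schreier graphs *)

Section CosetAction.
Variables (R : realType) (G : groupType) (K : set G).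
Hypothesis sK : subgroup K.

Lemma coset_mulM (v : coset K) g h : coset_mul (coset_mul v g) h = coset_mul v (g * h)%g.
Proof. by apply: val_inj; rewrite /= right_cosetM. Qed.

Lemma coset_mul1 (v : coset K) : coset_mul v 1%g = v.
Proof.
apply: val_inj => /=; apply/seteqP; split=> x.
  by case=> y vy <-; rewrite mulg1.
by move=> vx; exists x => //; rewrite mulg1.
Qed.

Lemma coset_mul_of g h : coset_mul (coset_of K g) h = coset_of K (g * h)%g.
Proof. by apply: val_inj; rewrite /= right_cosetM. Qed.

Lemma coset_of_eq g h : coset_of K g = coset_of K h <-> K (g * h^-1)%g.
Proof.
rewrite -(right_coset_eq g h sK); split=> [/(congr1 val)//|e]; exact: val_inj.
Qed.

Lemma coset_of_surj (v : coset K) : exists g, v = coset_of K g.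
Proof. by case: v => V VP; have /asboolP[g e] := VP; exists g; apply: val_inj. Qed.

Lemma coset_trans (v : coset K) : exists g, v = coset_mul (coset_of K 1%g) g.
Proof. by have [g ->] := coset_of_surj v; exists g; rewrite coset_mul_of mul1g. Qed.

Lemma infinite_coset : infinite_index K -> infinite_set [set: coset K].
Proof.
move=> iK fin; apply: iK.
apply: (@sub_finite_set _ _ ((fun v : coset K => val v) @` [set: coset K])); last exact: finite_image.
by move=> _ [g _ <-]; exists (coset_of K g).
Qed.

Variables (A : finType) (pi : A -> G).

Lemma iter_adj_words n (f : coset K -> R) v :
  iter n (adj (@coset_mul G K) pi) f v =
  \sum_(w : n.-tuple (A + A)) f (coset_mul v (word_val pi w)).
Proof.
elim: n v => [|n IH] v.
  rewrite (big_pred1 [tuple]) => [|w]; last by apply/esym/eqP; exact: tuple0.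
  by rewrite word_val_nil coset_mul1.
transitivity (\sum_(x : A + A)
    iter n (adj (@coset_mul G K) pi) f (coset_mul v (letter_val pi x))) => //.
under eq_bigr do rewrite IH.
rewrite pair_bigA /=.
rewrite (reindex (fun w : n.+1.-tuple (A + A) => (thead w, [tuple of behead w]))) /=; last first.
  exists (fun xw : (A + A) * n.-tuple (A + A) => cons_tuple xw.1 xw.2) => [w _|[x w] _] /=.
    by apply: val_inj => /=; case/tupleP: w => x w; rewrite theadE.
  by congr pair; apply: val_inj.
apply: eq_bigr => w _; rewrite coset_mulM; congr (f (coset_mul _ _)).
by case/tupleP: w => x w; rewrite theadE /= word_val_cons.
Qed.

Lemma iter_adj_count n :
  iter n (adj (@coset_mul G K) pi) (delta R (coset_of K 1%g)) (coset_of K 1%g) =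
  (word_count (MP K pi) n)%:R.
Proof.
rewrite iter_adj_words /word_count -sum1_card natr_sum [RHS]big_mkcond /=.
apply: eq_bigr => w _; rewrite coset_mul_of mul1g /delta inE.
have e : (coset_of K (word_val pi w) == coset_of K 1%g) = `[< MP K pi w >].
  apply/eqP/asboolP => [/coset_of_eq|Kw]; first by rewrite invg1 mulg1.
  by apply/coset_of_eq; rewrite invg1 mulg1.
by rewrite e; case: ifP.
Qed.

(** A path is determined by its origin and its labels, so counting closed paths at the base-vertex
    amounts to counting words. *)
Fixpoint schreier_path (v : coset K) (w : seq (A + A)) : seq (sg_edge K A) :=
  if w is x :: w' then (v, x) :: schreier_path (coset_mul v (letter_val pi x)) w'
  else [::].

Lemma size_schreier_path v w : size (schreier_path v w) = size w.
Proof. by elim: w v => //= x w IH v; rewrite IH. Qed.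

Lemma schreier_path_inj v : injective (schreier_path v).
Proof.
apply: (can_inj (g := map snd)) => w.
by elim: w v => //= x w IH v; rewrite IH.
Qed.

Lemma schreier_pathP (u v : coset K) (p : seq (sg_edge K A)) :
  @edge_path (schreier_graph K pi) u v p <->
  exists2 w, p = schreier_path u w & v = coset_mul u (word_val pi w).
Proof.
split.
  elim: p u => [|[u' x] p IH] u /=.
    by move=> <-; exists [::] => //; rewrite word_val_nil coset_mul1.
  move=> [-> /IH[w -> ->]]; exists (x :: w) => //.
  by rewrite word_val_cons coset_mulM.
case=> w -> ->; elim: w u => [|x w IH] u /=; first by rewrite word_val_nil coset_mul1.
split=> //; rewrite word_val_cons -coset_mulM; exact: IH.
Qed.

Lemma closed_path_countE n :
  closed_path_count (schreier_base K pi) n = word_count (MP K pi) n.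
Proof.
pose o := coset_of K 1%g.
have -> : closed_path_count (schreier_base K pi) n =
    #|` [fset schreier_path o w | w in words_fset (MP K pi) n]%fset|.
  rewrite /closed_path_count; set S := (X in fset_set X).
  have -> : S = [set` [fset schreier_path o w | w in words_fset (MP K pi) n]%fset].
    apply/seteqP; split=> p /=.
      case=> sp /schreier_pathP[w ep eo]; apply/imfsetP; exists w => //=.
      apply/words_fsetP; split; last by rewrite -sp ep size_schreier_path.
      move: eo; rewrite coset_mul_of mul1g => /esym/(proj1 (coset_of_eq _ _)).
      by rewrite invg1 mulg1.
    move=> /imfsetP[w /= /words_fsetP[Kw sw] ->]; split.
      by rewrite size_schreier_path.
    apply/schreier_pathP; exists w => //.
    by rewrite coset_mul_of mul1g; apply/esym/coset_of_eq; rewrite invg1 mulg1.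
  by rewrite set_fsetK.
rewrite card_imfset /=; last exact: schreier_path_inj.
exact: card_words_fset.
Qed.

Lemma degreeE : degree (schreier_base K pi) = #|{: A + A}|.
Proof.
pose o : coset K := coset_of K 1%g.
have -> : degree (schreier_base K pi) = #|` [fset (o, x) | x in {: A + A}]%fset|.
  rewrite /degree; set S := (X in fset_set X).
  have -> : S = [set` [fset (o, x) | x in {: A + A}]%fset].
    apply/seteqP; split=> -[u x] /= => [e|/imfsetP[y _ [-> _]] //].
    by have eu : u = o := e; apply/imfsetP; exists x; rewrite // eu.
  by rewrite set_fsetK.
rewrite card_imfset /=; last by move=> x y [].
by rewrite cardE.
Qed.

End CosetAction.

(** * Spectral radius and exponential bounds *)

Section SpectralRadius.
Variables (R : realType) (d : R) (b : nat -> R).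
Hypotheses (d0 : 0 < d) (b0 : forall n, 0 <= b n).

Let root n : \bar R := (b n `^ n%:R^-1)%:E.

Lemma root_le (s : R) n : (0 < n)%N -> 0 <= s -> b n <= s ^+ n -> (root n <= s%:E)%E.
Proof.
move=> n0 s0 bs; rewrite lee_fin.
have -> : s = (s ^+ n) `^ n%:R^-1.
  by rewrite -powR_mulrn // -powRrM mulfV ?powRr1 // pnatr_eq0 -lt0n.
by apply: ge0_ler_powR; rewrite ?nnegrE ?invr_ge0 ?exprn_ge0.
Qed.

Lemma root_lt (s : R) n : (0 < n)%N -> 0 <= s -> (root n < s%:E)%E -> b n <= s ^+ n.
Proof.
move=> n0 s0; rewrite lte_fin => h; rewrite leNgt; apply/negP => sb.
have : s <= b n `^ n%:R^-1.
  rewrite -[leLHS]powRr1 // -[X in _ `^ X](@mulfV _ n%:R) ?pnatr_eq0 -?lt0n //.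
  rewrite powRrM powR_mulrn //.
  by apply: ge0_ler_powR; rewrite ?nnegrE ?invr_ge0 ?exprn_ge0 // ltW.
by rewrite leNgt h.
Qed.

Lemma limn_esup_root_le (s : R) : 0 <= s -> (forall n, b n <= s ^+ n) ->
  (limn_esup root <= s%:E)%E.
Proof.
move=> s0 bs; apply: (@le_trans _ _ (ereal_sup (root @` [set n | (0 < n)%N]))).
  (* The index 0 is left out: the exponent [0^-1] is 0 there and [root 0] is 1 whatever [s] is. *)
  by apply: ereal_inf_lbound; exists [set n | (0 < n)%N] => //; exists 1%N.
by apply: ge_ereal_sup => _ [n n0 <-]; exact: root_le.
Qed.

(** A radius different from 1 leaves room for some [s] strictly between the upper limit and [d], and
    the root bound then holds from some index on. *)
Lemma decay_of_limn_esup : (forall n, b n <= d ^+ n) ->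
  (d^-1%:E * limn_esup root <> 1)%E ->
  exists s C : R, [/\ 0 < s, s < d & forall n, b n <= C * s ^+ n].
Proof.
move=> bd nu1.
have Ld := limn_esup_root_le (ltW d0) bd.
have {}Ld : (limn_esup root < d%:E)%E.
  rewrite lt_neqAle Ld andbT; apply/eqP => e; apply: nu1.
  by rewrite e -EFinM mulVf // gt_eqF.
have [L [L0 Ld' LE]] : exists L : R, [/\ 0 <= L, L < d & (limn_esup root <= L%:E)%E].
  case: (limn_esup root) Ld => [r|//|_].
  - rewrite lte_fin => rd; exists (Num.max 0 r).
    by rewrite le_max lexx gt_max d0 rd lee_fin le_max lexx orbT.
  - by exists 0; rewrite lexx d0 leNye.
pose s := (L + d) / 2.
have s0 : 0 < s by rewrite divr_gt0 // ltr_wpDl.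
have sd : s < d by rewrite /s; lra.
have Ls : L < s by rewrite /s; lra.
have /ereal_inf_lt[_ [V [N _ NV] <-] Vs] : (limn_esup root < s%:E)%E.
  by apply: (le_lt_trans LE); rewrite lte_fin.
(* The sum absorbs the finitely many indices up to [N]; the term 1 serves for the others. *)
pose C := 1 + \sum_(k < N.+1) b k / s ^+ k.
have C1 : 1 <= C by rewrite lerDl; apply: sumr_ge0 => k _; rewrite divr_ge0 // exprn_ge0 // ltW.
exists s, C; split=> // n.
have [nN|Nn] := ltnP n N.+1.
  rewrite -ler_pdivrMr ?exprn_gt0 // /C (bigD1 (Ordinal nN)) //= addrCA lerDl addr_ge0 //.
  by apply: sumr_ge0 => k _; rewrite divr_ge0 // exprn_ge0 // ltW.
apply: (@le_trans _ _ (s ^+ n)); last by rewrite ler_peMl // exprn_ge0 // ltW.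
apply: root_lt; [exact: leq_ltn_trans Nn|exact: ltW|].
apply: le_lt_trans Vs; apply: ereal_sup_ubound; exists n => //; apply: NV => /=.
exact: ltnW.
Qed.

Lemma spectral_radius_lt1 (s : R) : 0 <= s -> s < d -> (forall n, b n <= s ^+ n) ->
  (d^-1%:E * limn_esup root <> 1)%E.
Proof.
move=> s0 sd bs e; have := limn_esup_root_le s0 bs.
move=> /(lee_wpmul2l (_ : (0 <= d^-1%:E)%E)); rewrite e -EFinM => h.
have : (1 <= (d^-1 * s)%:E)%E by apply: h; rewrite lee_fin invr_ge0 ltW.
by rewrite lee_fin leNgt mulrC ltr_pdivrMr // mul1r sd.
Qed.

End SpectralRadius.

(** An empty family generates only the trivial group, which has no proper subgroup. A generator
    makes the degree positive. *)
Lemma generating_inhabited (G : groupType) (K : set G) (A : finType) (pi : A -> G) :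
  subgroup K -> K <> setT -> generating pi -> exists a : A, True.
Proof.
move=> sK KT gA; apply: contrapT => noA; apply: KT.
apply/seteqP; split=> // g _; apply: (generating_ind gA sK) => a.
by case: noA; exists a.
Qed.

Section SchreierGraphs.
Variables (R : realType) (G : groupType) (K : set G).
Hypothesis sK : subgroup K.
Variables (A : finType) (pi : A -> G).
Hypothesis gA : generating pi.

Lemma MP_generic_compl : infinite_index K -> generic R (~` MP K pi).
Proof.
move=> iK; have [a0 _] := generating_inhabited sK (infinite_index_proper iK) gA.
apply: generic_compl.
  rewrite card_sum; have : (0 < #|A|)%N by apply/card_gt0P; exists a0.
  by lia.
have := @return_count_cvg0 R _ _ _ (@coset_mulM G K) (@coset_mul1 G K) A pi a0 gA _
  (@coset_trans G K) (infinite_coset iK).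
by under eq_fun do rewrite iter_adj_count //.
Qed.

Lemma nonamenable_gap : infinite_index K -> ~ schreier_amenable R K pi ->
  exists2 eps : R, 0 < eps &
    forall f : coset K -> R, fsupp f ->
      eps * ip f f <= dirichlet (@coset_mul G K) pi f.
Proof.
move=> iK na; have [a0 _] := generating_inhabited sK (infinite_index_proper iK) gA.
have d0 : 0 < #|{: A + A}|%:R :> R by rewrite ltr0n; apply/card_gt0P; exists (inl a0).
have [s [C [s0 sd hb]]] : exists s C : R, [/\ 0 < s, s < #|{: A + A}|%:R &
    forall n, (word_count (MP K pi) n)%:R <= C * s ^+ n].
  apply: decay_of_limn_esup => //.
    by move=> n; rewrite -natrX ler_nat word_count_le.
  move=> e; apply: na; rewrite /schreier_amenable /amenable /spectral_radius degreeE -[RHS]e.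
  by congr (_ * limn_esup _)%E; apply/funext => n; rewrite closed_path_countE.
exists (#|{: A + A}|%:R - s); first by rewrite subr_gt0.
move=> f ff; apply: (decay_dirichlet (@coset_mulM G K) (@coset_mul1 G K) gA (@coset_trans G K) s0 _ ff).
by move=> n; rewrite iter_adj_count //; exact: hb.
Qed.

Lemma gap_word_count (eps : R) : 0 < eps -> infinite_index K ->
  (forall f : coset K -> R, fsupp f -> eps * ip f f <= dirichlet (@coset_mul G K) pi f) ->
  exists s : R, [/\ 0 <= s, s < #|{: A + A}|%:R &
    forall n, (word_count (MP K pi) n)%:R <= s ^+ n].
Proof.
move=> e0 iK gap; have [a0 _] := generating_inhabited sK (infinite_index_proper iK) gA.
set d : R := #|{: A + A}|%:R.
have d0 : 0 < d by rewrite ltr0n; apply/card_gt0P; exists (inl a0).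
(* The gap may be decreased, and [gap_decay] requires it to be below [d]. *)
pose e := Num.min eps (d / 2).
have ed : e < d by rewrite gt_min; apply/orP; right; lra.
have ee : 0 < e by rewrite lt_min e0 /=; lra.
exists (d - e); split; [by lra|by lra|move=> n].
rewrite -(iter_adj_count R sK).
apply: (gap_decay (@coset_mulM G K) (@coset_mul1 G K) _ ed) => f ff.
apply: le_trans (gap f ff); rewrite ler_wpM2r ?ip_ge0 //.
by rewrite ge_min lexx.
Qed.

Lemma word_count_nonamenable (s : R) : 0 <= s -> s < #|{: A + A}|%:R ->
  (forall n, (word_count (MP K pi) n)%:R <= s ^+ n) -> ~ schreier_amenable R K pi.
Proof.
move=> s0 sd hb; rewrite /schreier_amenable /amenable /spectral_radius degreeE.
have := @spectral_radius_lt1 R (#|{: A + A}|%:R) (fun n => (word_count (MP K pi) n)%:R)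
  (le_lt_trans s0 sd) (fun=> ler0n _ _) s s0 sd hb.
apply: contra_not => <-; congr (_ * limn_esup _)%E.
by apply/funext => n; rewrite closed_path_countE.
Qed.

End SchreierGraphs.

(** * From the cosets of [K] to those of its preimage *)

Section CosetTransfer.
Variables (R : realType) (G G' : groupType) (G1 : set G) (phi : G -> G') (K : set G').
Hypotheses (sG1 : subgroup G1) (fiG1 : finite_index G1).
Hypotheses (phiM : morphism_on G1 phi) (phi_onto : phi @` G1 = setT) (sK : subgroup K).
Variables (A B : finType) (pi : A -> G) (rho : B -> G').
Hypothesis gA : generating pi.

Let K1 := preimage_on G1 phi K.
Let sK1 : subgroup K1 := subgroup_preimage_on sG1 phiM sK.

Let lift_exists (v : coset K) : exists g, G1 g /\ coset_of K (phi g) = v.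
Proof.
have [y ->] := coset_of_surj v; have : (phi @` G1) y by rewrite phi_onto.
by case=> g G1g <-; exists g.
Qed.

Let lift v := sval (cid (lift_exists v)).
Let lift_in v : G1 (lift v). Proof. by rewrite /lift; case: cid => ? []. Qed.
Let liftK v : coset_of K (phi (lift v)) = v.
Proof. by rewrite /lift; case: cid => ? []. Qed.

Let coset_of_preimage g h : G1 g -> G1 h ->
  coset_of K1 g = coset_of K1 h <-> coset_of K (phi g) = coset_of K (phi h).
Proof.
by move=> G1g G1h; rewrite !coset_of_eq //; apply: preimage_onM.
Qed.

Let coset_of_mulr g h k :
  coset_of K1 (g * k)%g = coset_of K1 (h * k)%g <-> coset_of K1 g = coset_of K1 h.
Proof. by rewrite !coset_of_eq // invgM mulgA mulgK. Qed.

(** Through [phi] the cosets of [K] correspond to the cosets of [K1] inside [G1]; right translation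
    by the representative of [i] moves this copy into the coset [i] of [G1], and the copies cover
    everything. *)
Let j (i : fcoset G1) (v : coset K) : coset K1 :=
  coset_of K1 (lift v * coset_rep fiG1 i)%g.

Lemma coset_dirichlet_transfer (eps : R) : 0 < eps ->
  (forall f : coset K -> R, fsupp f -> eps * ip f f <= dirichlet (@coset_mul G' K) rho f) ->
  exists2 eps' : R, 0 < eps' &
    forall f : coset K1 -> R, fsupp f -> eps' * ip f f <= dirichlet (@coset_mul G K1) pi f.
Proof.
have [G11 G1M G1V] := sG1.
apply: (dirichlet_transfer (@coset_mulM G K1) (@coset_mul1 G K1) gA (j := j)).
- move=> i u v /coset_of_mulr/(coset_of_preimage (lift_in u) (lift_in v)).
  by rewrite !liftK.
- move=> v; have [g ->] := coset_of_surj v.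
  pose i := fcoset_of fiG1 g; pose h := (g * (coset_rep fiG1 i)^-1)%g.
  have G1h : G1 h by apply/(fcoset_ofP sG1 fiG1); rewrite coset_repK.
  exists i, (coset_of K (phi h)).
  have -> : g = (h * coset_rep fiG1 i)%g by rewrite /h mulgVK.
  by apply/coset_of_mulr/coset_of_preimage => //; rewrite liftK.
- move=> i b; have : (phi @` G1) (rho b) by rewrite phi_onto.
  (* A lift of [rho b], conjugated by the representative, since the copy [i] is translated by it. *)
  case=> g G1g gb; exists ((coset_rep fiG1 i)^-1 * g * coset_rep fiG1 i)%g => u.
  rewrite /j coset_mul_of !mulgA mulgK.
  apply/coset_of_mulr/coset_of_preimage => //; first exact: G1M.
  by rewrite liftK phiM // gb -{1}(liftK u) coset_mul_of.
Qed.

Lemma nonamenable_word_count : infinite_index K -> generating rho ->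
  ~ schreier_amenable R K rho ->
  exists s : R, [/\ 0 <= s, s < #|{: A + A}|%:R &
    forall n, (word_count (MP K1 pi) n)%:R <= s ^+ n].
Proof.
move=> iK gB na; have [eps e0 gap] := nonamenable_gap sK gB iK na.
have [eps' e0' gap'] := coset_dirichlet_transfer e0 gap.
exact: (gap_word_count sK1 gA e0' (infinite_index_preimage_on sG1 phiM sK phi_onto iK) gap').
Qed.

End CosetTransfer.

(** * Generic and strongly generic membership in [H] *)

Theorem theoremB (R : realType) (C : complexity_class)
    (G Gbar : groupType) (H G1 : set G) (phi : G -> Gbar) (Kbar : set Gbar)
    (fgG : finitely_generated [set: G])
    (sH : subgroup H) (fgH : finitely_generated H) (iH : infinite_index H)
    (sG1 : subgroup G1) (fiG1 : finite_index G1) (HG1 : H `<=` G1)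
    (phiM : morphism_on G1 phi) (phi_onto : phi @` G1 = [set: Gbar])
    (sK : subgroup Kbar) (iK : infinite_index Kbar) (HK : phi @` H `<=` Kbar)
    (memK : membership_in C Kbar) :
  membership_generically_in R C H /\
  ((exists (A : finType) (pi : A -> Gbar),
      generating pi /\ ~ schreier_amenable R Kbar pi) ->
   (forall (A : finType) (pi : A -> Gbar),
      generating pi -> ~ schreier_amenable R Kbar pi) /\
   membership_strongly_generically_in R C H).
Proof.
have KT := infinite_index_proper iK.
have sK1 := subgroup_preimage_on sG1 phiM sK.
have iK1 := infinite_index_preimage_on sG1 phiM sK phi_onto iK.
split.
  move=> A pi gA; have [M [mM cM dM]] :=
    partial_algorithm sG1 fiG1 HG1 phiM phi_onto sK KT HK memK gA.
  exists M; split=> //; exists (~` MP (preimage_on G1 phi Kbar) pi) => //.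
  exact: MP_generic_compl.
move=> [B [rho [gB na]]]; split=> [A pi gA|A pi gA].
  (* Independence of the generating set is the transfer result for [G1] the whole of [Gbar] and
     [phi] the identity, from [rho] to [pi]. *)
  have sT : subgroup [set: Gbar] by [].
  have fT : finite_index [set: Gbar].
    apply: (@sub_finite_set _ _ [set setT]) => // _ [g _ <-] /=.
    by apply/seteqP; split=> // x _; exists (x * g^-1)%g => //; rewrite mulgVK.
  have idT : id @` [set: Gbar] = setT by rewrite image_id.
  have [s [s0 sd hs]] := nonamenable_word_count sT fT
    (fun x y _ _ => erefl) idT sK gA iK gB na.
  have e : preimage_on [set: Gbar] id Kbar = Kbar.
    by apply/seteqP; split=> x //= -[].
  rewrite e in hs; exact: word_count_nonamenable hs.
have [M [mM cM dM]] := partial_algorithm sG1 fiG1 HG1 phiM phi_onto sK KT HK memK gA.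
exists M; split=> //; exists (~` MP (preimage_on G1 phi Kbar) pi) => //.
have [s [s0 sd hs]] := nonamenable_word_count sG1 fiG1 phiM phi_onto sK gA iK gB na.
have [a0 _] := generating_inhabited sK1 (infinite_index_proper iK1) gA.
apply: strongly_generic_compl sd hs _; last exact: MP_generic_compl.
rewrite card_sum; have : (0 < #|A|)%N by apply/card_gt0P; exists a0.
by lia.
Qed.
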